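(* Let $f,g$ be nonzero elements of $\mathcal F$. Then $\ker g\subseteq\ker f$ if and only if there exists $h\in\mathcal F$ with $f=h\circ g$. In this case $h$ is unique and $\ker h=g(\ker f)$.
   Context: Let $p$ be a prime, $q$ a power of $p$, and $C$ an algebraically closed field containing $\mathbb F_q$, complete with respect to a non-archimedean absolute value. $\mathcal F$ is the set of formal sums $f=\sum_{n\in\mathbb Z}a_n\tau^n$ ($a_n\in C$) such that $f(z)=\sum_na_nz^{q^n}$ converges for all $z\in C$ ($z^{q^n}$ for $n<0$ being the unique $q^{-n}$-th root); it is a ring under termwise addition and composition $(\sum a_i\tau^i)\circ(\sum b_j\tau^j)=\sum_n(\sum_{i+j=n}a_ib_j^{q^i})\tau^n$, corresponding to composition of maps $C\to C$. $\ker f=\{z\in C:f(z)=0\}$. *)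

(* Defs.v *)
From HB Require Import structures.
From mathcomp Require Import all_boot all_order all_algebra all_field.
From mathcomp Require Import mathcomp_extra boolp classical_sets functions.
From mathcomp Require Import reals topology normedtype sequences.
From mathcomp Require Import zify.

Set Implicit Arguments.
Unset Strict Implicit.
Unset Printing Implicit Defensive.

Import Order.TTheory GRing.Theory Num.Theory.
Import numFieldNormedType.Exports.

Local Open Scope classical_set_scope.
Local Open Scope ring_scope.

Record nonarch_absval (R : realType) (K : fieldType) := NonarchAbsval {
  absval :> K -> R;
  absval_ge0 : forall x, 0 <= absval x;
  absval_eq0 : forall x, absval x = 0 <-> x = 0;
  absvalM : forall x y, absval (x * y) = absval x * absval y;
  absval_ultra : forall x y, absval (x + y) <= Num.max (absval x) (absval y) }.

Section Convergence.
Variables (R : realType) (K : fieldType) (v : nonarch_absval R K).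

Definition v_cvg_to (u : nat -> K) (l : K) : Prop :=
  v (u n - l) @[n --> \oo] --> (0 : R).

Definition v_cauchy (u : nat -> K) : Prop :=
  forall e : R, 0 < e ->
    exists N : nat, forall m n : nat, (N <= m)%N -> (N <= n)%N -> v (u m - u n) < e.

Definition v_complete : Prop :=
  forall u : nat -> K, v_cauchy u -> exists l : K, v_cvg_to u l.

(* [Negz n] is the integer -(n + 1): the two halves of the series are required
   to converge separately. *)
Definition sumZ_to (u : int -> K) (l : K) : Prop :=
  exists l1 l2 : K,
    [/\ v_cvg_to (series (fun n : nat => u (Posz n))) l1,
        v_cvg_to (series (fun n : nat => u (Negz n))) l2 &
        l = l1 + l2].

Definition sumZ_cvg (u : int -> K) : Prop := exists l : K, sumZ_to u l.

Definition sumZ (u : int -> K) : K := xget 0 [set l | sumZ_to u l].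

Lemma v0 : v 0 = 0. Proof. exact/absval_eq0. Qed.

Lemma v1 : v 1 = 1.
Proof.
have v1_neq0 : v 1 != 0.
  by apply/eqP => /absval_eq0/eqP; rewrite oner_eq0.
by apply: (mulfI v1_neq0); rewrite -absvalM !mulr1.
Qed.

Lemma vX x n : v (x ^+ n) = v x ^+ n.
Proof. by elim: n => [|n IHn]; rewrite ?v1 // !exprS absvalM IHn. Qed.

Lemma vN x : v (- x) = v x.
Proof.
have /eqP : v (- x) ^+ 2 = v x ^+ 2 by rewrite -!vX sqrrN.
by rewrite eqrXn2 ?absval_ge0// => /eqP.
Qed.

Lemma v_ultraB x y e : v x < e -> v y < e -> v (x - y) < e.
Proof.
move=> xe ye; apply: le_lt_trans (absval_ultra v _ _) _.
by rewrite vN gt_max xe ye.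
Qed.

Lemma v_nullP (u : nat -> K) : v (u n) @[n --> \oo] --> (0 : R) <->
  forall e : R, 0 < e -> exists N, forall n, (N <= n)%N -> v (u n) < e.
Proof.
split.
  move=> /cvgr0Pnorm_lt uc e e0; have [N _ HN] := uc e e0.
  by exists N => n Nn; have := HN n Nn; rewrite ger0_norm ?absval_ge0.
move=> uc; apply/cvgr0Pnorm_lt => e e0; have [N HN] := uc e e0.
by exists N => // n Nn; rewrite ger0_norm ?absval_ge0//; apply: HN.
Qed.

Lemma v_cvg_to_unique u l l' : v_cvg_to u l -> v_cvg_to u l' -> l = l'.
Proof.
move=> /v_nullP ul /v_nullP ul'; apply/eqP; rewrite -subr_eq0; apply/eqP.
apply/(absval_eq0 v)/eqP; rewrite eq_le absval_ge0 andbT leNgt.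
apply/negP => e0; have [N HN] := ul _ e0; have [N' HN'] := ul' _ e0.
have := v_ultraB (HN' (maxn N N') (leq_maxr _ _))
                 (HN (maxn N N') (leq_maxl _ _)).
by rewrite opprB addrC addrA addrNK ltxx.
Qed.

Lemma sumZ_to_unique u l l' : sumZ_to u l -> sumZ_to u l' -> l = l'.
Proof.
move=> [a [b [ua ub ->]]] [a' [b' [ua' ub' ->]]].
by rewrite (v_cvg_to_unique ua ua') (v_cvg_to_unique ub ub').
Qed.

Lemma sumZP u : sumZ_cvg u -> sumZ_to u (sumZ u).
Proof. by move=> [l ul]; apply: (@xgetPex _ 0 [set l | sumZ_to u l]); exists l. Qed.

Lemma v_series_cvg (u : nat -> K) : v_complete ->
  v (u n) @[n --> \oo] --> (0 : R) -> exists l, v_cvg_to (series u) l.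
Proof.
move=> vc /v_nullP u0; apply: vc => e e0; have [N HN] := u0 e e0.
have H m n : (N <= m)%N -> (m <= n)%N -> v (series u n - series u m) < e.
  move=> Nm mn; rewrite sub_series mn big_nat_cond.
  apply: (big_ind (fun x => v x < e)) => [|x y xe ye|i]; first by rewrite v0.
    by rewrite -[y]opprK; apply: v_ultraB; rewrite ?vN.
  by rewrite andbT => /andP[mi _]; apply: HN; exact: leq_trans mi.
exists N => m n Nm Nn; have [mn|/ltnW nm] := leqP m n; last exact: H.
by rewrite -vN opprB; exact: H.
Qed.

Lemma v_series_null (u : nat -> K) l :
  v_cvg_to (series u) l -> v (u n) @[n --> \oo] --> (0 : R).
Proof.
move=> /v_nullP ul; apply/v_nullP => e e0; have [N HN] := ul e e0.
exists N => n Nn; have := v_ultraB (HN n.+1 (leqW Nn)) (HN n Nn).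
by rewrite opprB addrA addrNK seriesSr/= addrAC subrr add0r.
Qed.

End Convergence.

Section FractionalPowerSeries.
Variables (R : realType) (C : closedFieldType) (v : nonarch_absval R C) (q : nat).

(* z^(q^n); for n < 0 the q^(-n)-th root of z, which exists since C is
   algebraically closed, and is unique when q is a power of the characteristic
   (see [qpow_neg_unique]). *)
Definition qpow (z : C) (n : int) : C :=
  match n with
  | Posz m => z ^+ (q ^ m)%N
  | Negz m => xget 0 [set y | y ^+ (q ^ m.+1)%N = z]
  end.

(* A formal sum \sum_(n in Z) a_n tau^n is its coefficient function int -> C. *)
Definition calF : set (int -> C) :=
  [set f | forall z : C, sumZ_cvg v (fun n => f n * qpow z n)].

Definition feval (f : int -> C) (z : C) : C := sumZ v (fun n => f n * qpow z n).

Definition fker (f : int -> C) : set C := [set z | feval f z = 0].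

(* The coefficient sums converge when f and g belong to [calF]
   (see [fcomp_cvg]). *)
Definition fcomp (f g : int -> C) : int -> C :=
  fun n => sumZ v (fun i => f i * qpow (g (n - i)) i).

Lemma qpow_neg_unique (p k : nat) (z : C) (m : nat) :
  p \in [pchar C] -> q = (p ^ k)%N ->
  forall y, y ^+ (q ^ m.+1)%N = z <-> y = qpow z (Negz m).
Proof.
move=> pC qE y; set N := (q ^ m.+1)%N.
have p0 : (0 < p)%N by apply: prime_gt0; exact: pcharf_prime pC.
have NE : N = (p ^ (k * m.+1))%N by rewrite /N qE expnM.
have N0 : (0 < N)%N by rewrite NE expn_gt0 p0.
have ex : exists x : C, x ^+ N = z.
  have [x xE] := @solve_monicpoly C N (fun i => if i == 0%N then z else 0) N0.
  exists x; rewrite xE (bigD1 (Ordinal N0))//= expr0 mulr1 big1 ?addr0// => i.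
  by rewrite -val_eqE/= => /negbTE ->; rewrite mul0r.
have rE : qpow z (Negz m) ^+ N = z.
  by apply: (@xgetPex _ 0 [set y | y ^+ N = z]).
have Ninj : injective (fun x : C => x ^+ N).
  move=> a b /= /eqP; rewrite NE -{1}(subrK b a) exprDn_pchar; last first.
    by rewrite (eq_pnat _ (pcharf_eq pC)) pnatX pnat_id ?(pcharf_prime pC).
  by rewrite -subr_eq0 addrK expf_eq0 subr_eq0 => /andP[_ /eqP].
by split=> [yz|->//]; apply: Ninj; rewrite /= rE.
Qed.

Lemma fcomp_cvg (p k : nat) (f g : int -> C) (n : int) :
  p \in [pchar C] -> q = (p ^ k)%N -> v_complete v -> calF f -> calF g ->
  sumZ_cvg v (fun i => f i * qpow (g (n - i)) i).
Proof.
move=> pC qE vc fF gF.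
have p0 : (0 < p)%N by apply: prime_gt0; exact: pcharf_prime pC.
have qpow1 i : qpow 1 i = 1.
  case: i => m; first by rewrite /= expr1n.
  by symmetry; apply/(qpow_neg_unique _ _ pC qE); rewrite expr1n.
have null1 (h : int -> C) : calF h ->
    v (h (Posz i)) @[i --> \oo] --> (0 : R) /\
    v (h (Negz i)) @[i --> \oo] --> (0 : R).
  move=> /(_ 1) [l [l1 [l2 [c1 c2 _]]]].
  have hE i : h i = h i * qpow 1 i by rewrite qpow1 mulr1.
  split; [under eq_fun do rewrite hE|under eq_fun do rewrite hE].
    exact: v_series_null c1.
  exact: v_series_null c2.
have vq1 x i : v x < 1 -> v (qpow x i) <= 1.
  move=> x1; case: i => m.
    by rewrite vX exprn_ile1 ?absval_ge0// ltW.
  have /(qpow_neg_unique _ _ pC qE)/(congr1 v) := erefl (qpow x (Negz m)).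
  rewrite vX => H; rewrite -(@expr_le1 _ (q ^ m.+1)) ?absval_ge0 ?H ?ltW//.
  by rewrite qE expn_gt0 expn_gt0 p0.
have [f1 f2] := null1 f fF; have [g1 g2] := null1 g gF.
move/v_nullP: g1 => /(_ 1 ltr01)[M1 HM1].
move/v_nullP: g2 => /(_ 1 ltr01)[M2 HM2].
have comp0 (s : nat -> int) M : v (f (s i)) @[i --> \oo] --> (0 : R) ->
    (forall i, (M <= i)%N -> v (g (n - s i)) < 1) ->
    v (f (s i) * qpow (g (n - s i)) (s i)) @[i --> \oo] --> (0 : R).
  move=> /v_nullP fs gs; apply/v_nullP => e e0; have [N HN] := fs e e0.
  exists (maxn N M) => i; rewrite geq_max => /andP[Ni Mi].
  rewrite absvalM; apply: le_lt_trans (HN i Ni).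
  by apply: ler_piMr; [exact: absval_ge0|exact/vq1/gs].
have [l1 c1] : exists l, v_cvg_to v (series (fun i : nat =>
    f (Posz i) * qpow (g (n - Posz i)) (Posz i))) l.
  apply: v_series_cvg => //; apply: (comp0 Posz (`|n|%N + M2).+1) => // i iM.
  have -> : n - Posz i = Negz (`|n - Posz i|%N).-1 by lia.
  by apply: HM2; lia.
have [l2 c2] : exists l, v_cvg_to v (series (fun i : nat =>
    f (Negz i) * qpow (g (n - Negz i)) (Negz i))) l.
  apply: v_series_cvg => //; apply: (comp0 Negz (`|n|%N + M1).+1) => // i iM.
  have -> : n - Negz i = Posz (`|n - Negz i|%N) by lia.
  by apply: HM1; lia.
by exists (l1 + l2), l1, l2.
Qed.

End FractionalPowerSeries.

(* Main.v *)
Require Import Defs.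
From HB Require Import structures.
From mathcomp Require Import all_boot all_order all_algebra all_field.
From mathcomp Require Import mathcomp_extra boolp classical_sets functions.
From mathcomp Require Import reals topology normedtype sequences.
From mathcomp Require Import exp.
From mathcomp Require Import zify ring lra.

Set Implicit Arguments.
Unset Strict Implicit.
Unset Printing Implicit Defensive.

Import Order.TTheory GRing.Theory Num.Theory.
Import numFieldNormedType.Exports.

Local Open Scope classical_set_scope.
Local Open Scope ring_scope.

(** For rho > 0 put |f|_rho = max_n |a_n| rho^(q^n). As in Gauss's lemma,
    |f o g|_rho = |f|_(|g|_rho), and the first (last) indices at which the
    maximum is attained add up under composition; this gives uniqueness of h.

    Solving truncated polynomial equations and correcting the error shows that
    a nonzero g is surjective, and that whenever the maximum in |g|_rho is
    attained at two indices, g has a zero l with |l| = rho. Such a zero splits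
    off on the right: g = g1 o (1 - l^(1-q) tau), and so does any zero of f.

    Let ker g be contained in ker f and fix an annulus s <= |z| <= r. Splitting
    off from both f and g the finitely many zeros of g in the annulus reduces to
    the case where a single monomial b tau^m of g is dominant there; then
    h = f o (b tau^m)^-1 satisfies |h|_(|g|_rho) <= |f|_rho, and f - h o g is
    small on the annulus. As s tends to 0 and r to infinity these h form a Cauchy
    sequence for all the norms, by Gauss's lemma, and the limit is the quotient. *)

(** * Sums of null families *)

(** The zeros of g may accumulate both at 0 and at infinity, and splitting one off on the right
    moves the others, since the zeros of g1 are the images of those of g. An infinite product over
    the zeros is therefore replaced by finitely many divisions for each annulus, followed by a
    limit. The limit works without iterating the approximation. Under composition the norm of the
    inner series acts as a radius of the outer one, not as a factor. If g2 is what remains of g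
    after removing its dominant monomial, then f - h o g = - h o g2, and its norm at rho is at most
    that of h at a radius bounding the terms of g2. Since q >= 2, a change of index by one at least
    squares, or at most takes the square root of, a ratio of radii; hence this bound tends to 0 as
    the annulus grows. Once it is below |g|_sigma for some sigma in the annulus, the estimate
    |h|_(|g|_sigma) <= |f|_sigma applies, and |f|_sigma tends to 0 with sigma because all exponents
    q^n are positive. *)

Section NullFamilies.
Variable R : realType.

(* Convergence to 0 along the cofinite filter of the index type. *)
Definition rnull (I : eqType) (a : I -> R) : Prop :=
  forall e : R, 0 < e -> exists r : seq I, forall i, i \notin r -> a i < e.

Lemma rnull_le (I : eqType) (a b : I -> R) :
  (forall i, a i <= b i) -> rnull b -> rnull a.
Proof.
move=> ab nb e e0; have [r hr] := nb e e0.
by exists r => i /hr; apply: le_lt_trans.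
Qed.

Lemma rnull_intP (a : int -> R) : rnull a <->
  forall e, 0 < e -> exists N : nat, forall n, (N <= `|n|)%N -> a n < e.
Proof.
split=> na e /na.
  move=> [r hr]; exists (\max_(i <- r) `|i|%N).+1 => n nN; apply: hr.
  apply/negP => nr; move: nN; rewrite ltnNge => /negP; apply.
  by rewrite (big_rem n nr) /= leq_maxl.
move=> [N hN]; exists (map (fun k : nat => k%:Z - N%:Z) (iota 0 (N + N))) => n.
move=> nr; apply: hN; rewrite leqNgt; apply/negP => nN; move/negP: nr; apply.
apply/mapP; exists (absz (n + N%:Z)); first by rewrite mem_iota; lia.
by lia.
Qed.

(** All but finitely many values lie below a given positive value, so the maximum is that of a
    finite list. *)
Lemma rnull_argmax (I : eqType) (a : I -> R) (i0 : I) :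
  (forall i, 0 <= a i) -> rnull a -> exists i, forall j, a j <= a i.
Proof.
move=> a0 na.
have [[i ai]|ni] := pselect (exists i, 0 < a i); last first.
  exists i0 => j; apply: le_trans (a0 _); rewrite leNgt; apply/negP => aj.
  by apply: ni; exists j.
have [r hr] := na _ ai.
have [m hm] : exists m, forall j, j \in i :: r -> a j <= a m.
  elim: (i :: r) => [|x s [m hm]]; first by exists i.
  have [xm|/ltW mx] := leP (a x) (a m).
    by exists m => j; rewrite in_cons => /predU1P[->//|/hm].
  exists x => j; rewrite in_cons => /predU1P[->//|/hm jm]; exact: le_trans mx.
exists m => j; have [jr|/hr jr] := boolP (j \in r).
  by apply: hm; rewrite in_cons jr orbT.
by apply: le_trans (ltW jr) _; apply: hm; rewrite mem_head.
Qed.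

Lemma int_ex_min (P : int -> Prop) (N : nat) :
  (forall n, P n -> (`|n| <= N)%N) -> (exists n, P n) ->
  exists2 n, P n & forall m, P m -> n <= m.
Proof.
move=> PN [n0 Pn0].
have ex : exists k : nat, `[< P (k%:Z - N%:Z) >].
  exists (absz (n0 + N%:Z)); apply/asboolP.
  by have -> : (absz (n0 + N%:Z))%:Z - N%:Z = n0 by have := PN _ Pn0; lia.
case: (ex_minnP ex) => k /asboolP Pk kmin; exists (k%:Z - N%:Z) => // m Pm.
have mN := PN _ Pm.
have : (k <= absz (m + N%:Z)%R)%N.
  apply: kmin; apply/asboolP.
  by have -> : (absz (m + N%:Z))%:Z - N%:Z = m by lia.
by lia.
Qed.

Lemma int_ex_max (P : int -> Prop) (N : nat) :
  (forall n, P n -> (`|n| <= N)%N) -> (exists n, P n) ->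
  exists2 n, P n & forall m, P m -> m <= n.
Proof.
move=> PN [n0 Pn0].
have PN' n : P (- n) -> (`|n| <= N)%N by move=> /PN; rewrite abszN.
have exN : exists n, P (- n) by exists (- n0); rewrite opprK.
have [n Pn nmin] := int_ex_min PN' exN.
by exists (- n) => // m Pm; have := nmin (- m); rewrite opprK => /(_ Pm); lia.
Qed.

End NullFamilies.

(** * Two-sided sums in a complete ultrametric field *)

Section Sums.
Variables (R : realType) (K : fieldType) (v : nonarch_absval R K).
Hypothesis vc : v_complete v.

Definition vnull (I : eqType) (u : I -> K) : Prop := rnull (fun i => v (u i)).

Lemma v_le_add x y B : v x <= B -> v y <= B -> v (x + y) <= B.
Proof.
by move=> xB yB; apply: le_trans (absval_ultra v x y) _; rewrite ge_max xB.
Qed.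

Lemma v_eq0 x : (v x == 0) = (x == 0).
Proof. by apply/eqP/eqP => [/absval_eq0|->]; rewrite ?v0. Qed.

Lemma v_gt0 x : (0 < v x) = (x != 0).
Proof. by rewrite lt_def absval_ge0 andbT v_eq0. Qed.

Lemma vV x : v x^-1 = (v x)^-1.
Proof.
have [->|x0] := eqVneq x 0; first by rewrite invr0 v0 invr0.
have vx0 : v x != 0 by rewrite v_eq0.
by apply: (mulfI vx0); rewrite -absvalM !divff ?v1.
Qed.

Lemma v_eps_eq0 x : (forall e, 0 < e -> v x <= e) -> x = 0.
Proof.
move=> h; apply/(absval_eq0 v)/eqP; rewrite eq_le absval_ge0 andbT leNgt.
by apply/negP => x0; have := h (v x / 2) (divr_gt0 x0 (ltr0Sn _ 1)); lra.
Qed.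

Lemma vnullD (I : eqType) (u w : I -> K) :
  vnull u -> vnull w -> vnull (fun i => u i + w i).
Proof.
move=> nu nw e e0; have [r hr] := nu e e0; have [s hs] := nw e e0.
exists (r ++ s) => i; rewrite mem_cat negb_or => /andP[/hr ir /hs si].
by apply: le_lt_trans (absval_ultra v _ _) _; rewrite gt_max ir.
Qed.

Lemma vnull_delta (I : eqType) (a : I) c :
  vnull (fun i => if i == a then c else 0).
Proof.
by move=> e e0; exists [:: a] => i; rewrite inE => /negbTE ->; rewrite v0.
Qed.

Lemma vnull_off (I : eqType) (u : I -> K) (P : pred I) :
  vnull u -> vnull (fun i => if P i then u i else 0).
Proof.
apply: rnull_le => i; case: (P i) => //; by rewrite v0 absval_ge0.
Qed.

Lemma vnull_sumZ_cvg (u : int -> K) : vnull u <-> sumZ_cvg v u.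
Proof.
split=> [/rnull_intP nu|[l [l1 [l2 [c1 c2 _]]]]].
  have [l1 c1] : exists l, v_cvg_to v (series (fun n : nat => u (Posz n))) l.
    apply: v_series_cvg => //; apply/v_nullP => e /nu[N hN].
    by exists N => n nN; apply: hN.
  have [l2 c2] : exists l, v_cvg_to v (series (fun n : nat => u (Negz n))) l.
    apply: v_series_cvg => //; apply/v_nullP => e /nu[N hN].
    by exists N => n nN; apply: hN; lia.
  by exists (l1 + l2), l1, l2.
move/v_series_null/v_nullP: c1 => c1; move/v_series_null/v_nullP: c2 => c2.
apply/rnull_intP => e e0; have [N1 h1] := c1 e e0; have [N2 h2] := c2 e e0.
exists (N1 + N2).+1 => -[n|n] nN; [apply: h1|apply: h2]; lia.
Qed.

Lemma vnull_sumZ_to u : vnull u -> sumZ_to v u (sumZ v u).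
Proof. by move=> /vnull_sumZ_cvg/sumZP. Qed.

Lemma v_cvg_toD a b l m :
  v_cvg_to v a l -> v_cvg_to v b m -> v_cvg_to v (fun n => a n + b n) (l + m).
Proof.
move=> /v_nullP al /v_nullP bm; apply/v_nullP => e e0.
have [N hN] := al e e0; have [M hM] := bm e e0.
exists (maxn N M) => n; rewrite geq_max => /andP[/hN an /hM bn].
have -> : a n + b n - (l + m) = (a n - l) + (b n - m) by ring.
by apply: le_lt_trans (absval_ultra v _ _) _; rewrite gt_max an.
Qed.

Lemma v_cvg_to_le a l B : v_cvg_to v a l -> (forall n, v (a n) <= B) -> v l <= B.
Proof.
move=> /v_nullP al aB; rewrite leNgt; apply/negP => Bl.
have l0 : 0 < v l by apply: le_lt_trans Bl; apply: le_trans (aB 0%N); exact: absval_ge0.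
have [N hN] := al _ l0; have := hN _ (leqnn N).
rewrite ltNge => /negP; apply.
have -> : l = a N - (a N - l) by ring.
rewrite leNgt; apply/negP => h.
have h1 : v (a N) < v l by exact: le_lt_trans (aB _) Bl.
have h2 := hN _ (leqnn N).
have := v_ultraB h1 h2.
have -> : a N - (a N - l) = l by ring.
by rewrite ltxx.
Qed.

Lemma sumZD u w : vnull u -> vnull w ->
  sumZ v (fun i => u i + w i) = sumZ v u + sumZ v w.
Proof.
move=> nu nw; apply: (@sumZ_to_unique _ _ v (fun i => u i + w i)).
  exact/vnull_sumZ_to/vnullD.
have [l1 [l2 [c1 c2 ->]]] := vnull_sumZ_to nu.
have [m1 [m2 [d1 d2 ->]]] := vnull_sumZ_to nw.
exists (l1 + m1), (l2 + m2); split; last by rewrite addrACA.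
- rewrite (_ : series _ = (fun n => series (fun n : nat => u (Posz n)) n +
    series (fun n : nat => w (Posz n)) n)); first exact: v_cvg_toD.
  by apply/funext => n; rewrite /series /= big_split.
- rewrite (_ : series _ = (fun n => series (fun n : nat => u (Negz n)) n +
    series (fun n : nat => w (Negz n)) n)); first exact: v_cvg_toD.
  by apply/funext => n; rewrite /series /= big_split.
Qed.

Lemma v_sum_le (I : Type) (r : seq I) (P : pred I) (F : I -> K) B : 0 <= B ->
  (forall i, P i -> v (F i) <= B) -> v (\sum_(i <- r | P i) F i) <= B.
Proof.
move=> B0 FB; apply: (big_ind (fun x => v x <= B)) => //; first by rewrite v0.
by move=> x y; exact: v_le_add.
Qed.

Lemma sumZ_le u B : vnull u -> (forall i, v (u i) <= B) -> v (sumZ v u) <= B.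
Proof.
move=> nu uB; have [l1 [l2 [c1 c2 ->]]] := vnull_sumZ_to nu.
have B0 : 0 <= B by apply: le_trans (uB 0); exact: absval_ge0.
apply: v_le_add; [apply: (v_cvg_to_le c1)|apply: (v_cvg_to_le c2)] => n;
  exact: v_sum_le.
Qed.

Lemma v_cvg_series_delta (m : nat) c :
  v_cvg_to v (series (fun n => if n == m then c else 0)) c.
Proof.
apply/v_nullP => e e0; exists m.+1 => n mn.
rewrite /series /= -big_mkcond /= big_mkord (big_pred1 (Ordinal mn)) ?subrr ?v0 //.
Qed.

Lemma v_cvg_series0 : v_cvg_to v (series (fun=> 0)) 0.
Proof.
apply/v_nullP => e e0; exists 0%N => n _.
by rewrite /series /= big1 // subrr v0.
Qed.

Lemma sumZ_delta a c : sumZ v (fun i => if i == a then c else 0) = c.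
Proof.
apply: (@sumZ_to_unique _ _ v (fun i => if i == a then c else 0)).
  exact/vnull_sumZ_to/vnull_delta.
case: a => m.
  exists c, 0; split; rewrite ?addr0 //; last exact: v_cvg_series0.
  exact: v_cvg_series_delta.
exists 0, c; split; rewrite ?add0r //; first exact: v_cvg_series0.
exact: v_cvg_series_delta.
Qed.

(* Reduces identities between infinite sums (interchange of summations, powers
   and multiples of a sum) to families supported at one point. *)
Lemma vnull_ext (I : eqType) (D : (I -> K) -> K) :
  (forall u w, vnull u -> vnull w -> D (fun i => u i + w i) = D u + D w) ->
  (forall a c, D (fun i => if i == a then c else 0) = 0) ->
  (forall e, 0 < e -> exists2 d, 0 < d &
     forall u, vnull u -> (forall i, v (u i) <= d) -> v (D u) <= e) ->
  forall u, vnull u -> D u = 0.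
Proof.
move=> Dadd Dd Dc u nu; apply: v_eps_eq0 => e e0.
have [d d0 hd] := Dc e e0; have [r hr] := nu d d0.
have {hr} : forall i, i \notin r -> v (u i) <= d by move=> i /hr/ltW.
elim: r u nu => [|a r IHr] u nu hr; first by apply: hd => // i; apply: hr.
have uE : u = fun i => (if i == a then u a else 0) + (if i != a then u i else 0).
  by apply/funext => i; case: eqP => [->|_] /=; rewrite ?addr0 ?add0r.
rewrite uE Dadd; [|exact: vnull_delta|exact: vnull_off].
rewrite Dd add0r; apply: IHr => [|i ir]; first exact: vnull_off.
have [_|ia] := eqVneq i a; first by rewrite v0 ltW.
by apply: hr; rewrite in_cons negb_or ia.
Qed.

Lemma sumZ_finite (r : seq int) (u : int -> K) : uniq r ->
  (forall i, i \notin r -> u i = 0) -> sumZ v u = \sum_(i <- r) u i.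
Proof.
elim: r u => [|a r IHr] u /=.
  move=> _ u0; rewrite big_nil.
  rewrite (_ : u = fun i => if i == 0 then 0 else 0) ?sumZ_delta //.
  by apply/funext => i; rewrite u0 ?if_same.
move=> /andP[ar ur] hu.
have nu (w : int -> K) (s : seq int) : (forall i, i \notin s -> w i = 0) -> vnull w.
  by move=> hs e e0; exists s => i /hs ->; rewrite v0.
have uE : u = fun i => (if i == a then u a else 0) + (if i != a then u i else 0).
  by apply/funext => i; case: eqP => [->|_] /=; rewrite ?addr0 ?add0r.
rewrite uE sumZD; [|exact: vnull_delta|exact/vnull_off/nu/hu].
rewrite sumZ_delta (IHr _ ur) => [|i ir]; last first.
  by have [//|ia] := eqVneq i a; apply: hu; rewrite in_cons negb_or ia.
rewrite big_cons eqxx /= addr0; congr (_ + _); rewrite big_seq [RHS]big_seq.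
apply: eq_bigr => i ir.
by have [ia|] := eqVneq i a; [rewrite ia (negbTE ar) in ir|rewrite add0r].
Qed.

Lemma vnull_map (phi : K -> K) (I : eqType) (u : I -> K) :
  (forall e, 0 < e -> exists2 d, 0 < d & forall x, v x <= d -> v (phi x) <= e) ->
  vnull u -> vnull (fun i => phi (u i)).
Proof.
move=> pc nu e e0; have [d d0 hd] := pc (e / 2) (divr_gt0 e0 (ltr0Sn _ 1)).
have [r hr] := nu d d0; exists r => i /hr/ltW/hd h.
by apply: le_lt_trans h _; lra.
Qed.

(** Additivity instead of linearity lets the same lemma serve for multiplication by a constant and
    for [qpow^~ i]. *)
Lemma sumZ_map (phi : K -> K) u :
  {morph phi : x y / x + y} ->
  (forall e, 0 < e -> exists2 d, 0 < d & forall x, v x <= d -> v (phi x) <= e) ->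
  vnull u -> phi (sumZ v u) = sumZ v (fun i => phi (u i)).
Proof.
move=> pD pc nu; have p0 : phi 0 = 0 by apply: (addIr (phi 0)); rewrite -pD !add0r.
apply/eqP; rewrite -subr_eq0; apply/eqP; move: u nu.
apply: vnull_ext => [u w nu nw|a c|e e0].
- rewrite sumZD // pD.
  under [X in _ - sumZ v X = _]eq_fun do rewrite pD.
  by rewrite sumZD; [ring|exact: vnull_map|exact: vnull_map].
- rewrite sumZ_delta (_ : (fun i => _) = fun i => if i == a then phi c else 0).
    by rewrite sumZ_delta subrr.
  by apply/funext => i; case: ifP.
- have [d d0 hd] := pc e e0; exists d => // u nu ud; apply: v_le_add.
    exact/hd/sumZ_le.
  by rewrite vN; apply: sumZ_le => [|i]; [exact: vnull_map|exact: hd].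
Qed.

Lemma mull_continuous (c : K) (e : R) : 0 < e ->
  exists2 d, 0 < d & forall x, v x <= d -> v (c * x) <= e.
Proof.
move=> e0; have c1 : 0 < v c + 1 by rewrite ltr_wpDl // absval_ge0.
exists (e / (v c + 1)) => [|x]; first exact: divr_gt0.
rewrite ler_pdivlMr // absvalM => h; apply: le_trans h.
by rewrite mulrC ler_wpM2l ?absval_ge0 // lerDl.
Qed.

Lemma sumZ_mull c u : vnull u -> c * sumZ v u = sumZ v (fun i => c * u i).
Proof. by apply: sumZ_map; [exact: mulrDr|exact: mull_continuous]. Qed.

Lemma sumZN u : vnull u -> - sumZ v u = sumZ v (fun i => - u i).
Proof.
move=> nu; rewrite -mulN1r sumZ_mull //.
by congr sumZ; apply/funext => i; rewrite mulN1r.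
Qed.

(** In an ultrametric field a strictly largest term cannot be cancelled. This turns dominance of a
    term into exact values of norms, and into nonvanishing. *)
Lemma sumZ_dominant u i0 : vnull u ->
  (forall i, i != i0 -> v (u i) < v (u i0)) -> v (sumZ v u) = v (u i0).
Proof.
move=> nu hu.
have uE : u = fun i => (if i == i0 then u i0 else 0) + (if i != i0 then u i else 0).
  by apply/funext => i; case: eqP => [->|_] /=; rewrite ?addr0 ?add0r.
set w := fun i => if i != i0 then u i else 0.
have nw : vnull w by exact: vnull_off.
have sE : sumZ v u = u i0 + sumZ v w.
  by rewrite {1}uE sumZD ?sumZ_delta //; exact: vnull_delta.
(* Strict inequality for each term does not suffice for an infinite sum; as the remaining terms form
   a null family, their maximum is attained, which gives one strict bound for all of them. *)
have [m hm] := rnull_argmax 0 (fun i => absval_ge0 v (w i)) nw.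
have wle : v (sumZ v w) <= v (w m) by exact: sumZ_le.
have : v (w m) < v (u i0) \/ v (u i0) = 0.
  rewrite /w; case: eqP => [_|/eqP mi] /=; last by left; exact: hu.
  rewrite v0; have := absval_ge0 v (u i0).
  by rewrite le_eqVlt => /predU1P[<-|]; [right|left].
case=> [wlt|u0].
  apply/eqP; rewrite eq_le; apply/andP; split.
    by rewrite sE; apply: v_le_add => //; apply: le_trans wle (ltW wlt).
  rewrite leNgt; apply/negP => slt.
  have := v_ultraB slt (le_lt_trans wle wlt).
  by rewrite sE addrK ltxx.
apply/eqP; rewrite eq_le u0 absval_ge0 andbT; apply: sumZ_le => // i.
have [->|/hu] := eqVneq i i0; first by rewrite u0.
by rewrite u0 => /ltW.
Qed.

(** The parametrization [phi] of the plane is kept general so that summation by rows and by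
    antidiagonals share their lemmas. *)
Definition dsumZ (phi : int -> int -> int * int) (t : int * int -> K) : K :=
  sumZ v (fun a => sumZ v (fun b => t (phi a b))).

Section DoubleSums.
Variables (phi : int -> int -> int * int) (f1 f2 : int * int -> int).
Hypotheses (phi1 : forall a b, f1 (phi a b) = a)
  (phi2 : forall a b, f2 (phi a b) = b) (phiK : forall x, phi (f1 x) (f2 x) = x).

Lemma vnull_slice t a : vnull t -> vnull (fun b => t (phi a b)).
Proof.
move=> nt e e0; have [r hr] := nt e e0; exists (map f2 r) => b br; apply: hr.
by apply: contra br => pr; apply/mapP; exists (phi a b).
Qed.

Lemma vnull_slice_sum t : vnull t -> vnull (fun a => sumZ v (fun b => t (phi a b))).
Proof.
move=> nt e e0; have [r hr] := nt (e / 2) (divr_gt0 e0 (ltr0Sn _ 1)).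
exists (map f1 r) => a ar; apply: (@le_lt_trans _ _ (e / 2)); last by lra.
apply: sumZ_le => [|b]; first exact: vnull_slice.
apply/ltW/hr; by apply: contra ar => pr; apply/mapP; exists (phi a b).
Qed.

Lemma dsumZD t t' : vnull t -> vnull t' ->
  dsumZ phi (fun x => t x + t' x) = dsumZ phi t + dsumZ phi t'.
Proof.
move=> nt nt'; rewrite /dsumZ -sumZD; [|exact: vnull_slice_sum..].
by congr sumZ; apply/funext => a; rewrite sumZD //; exact: vnull_slice.
Qed.

Lemma dsumZ_le t B : vnull t -> (forall x, v (t x) <= B) -> v (dsumZ phi t) <= B.
Proof.
move=> nt tB; apply: sumZ_le => [|a]; first exact: vnull_slice_sum.
by apply: sumZ_le => [|b]; first exact: vnull_slice.
Qed.

Lemma dsumZ_delta x c : dsumZ phi (fun y => if y == x then c else 0) = c.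
Proof.
rewrite /dsumZ -[RHS](sumZ_delta (f1 x)); congr sumZ; apply/funext => a.
case: eqP => [->|ax].
  rewrite -[RHS](sumZ_delta (f2 x)); congr sumZ; apply/funext => b.
  case: eqP => [<-|px]; first by rewrite phi2 eqxx.
  by case: eqP => // bx; case: px; rewrite bx phiK.
rewrite -[RHS](sumZ_delta 0); congr sumZ; apply/funext => b; rewrite if_same.
by case: eqP => // px; case: ax; rewrite -px phi1.
Qed.

End DoubleSums.

(** The difference of the two iterated sums is additive, bounded by the largest term, and zero on
    families supported at one point, so [vnull_ext] applies. *)
Lemma dsumZ_antidiagonal t : vnull t ->
  dsumZ pair t = dsumZ (fun n i => (i, n - i)) t.
Proof.
move=> nt; apply/eqP; rewrite -subr_eq0; apply/eqP; move: t nt.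
pose f1 (x : int * int) := x.1; pose f2 (x : int * int) := x.2.
pose f3 (x : int * int) := x.1 + x.2; pose phi (n i : int) := (i, n - i).
have p1 (a b : int) : f1 (a, b) = a by [].
have p2 (a b : int) : f2 (a, b) = b by [].
have pK x : (f1 x, f2 x) = x by case: x.
have a1 n i : f3 (phi n i) = n by rewrite /f3 /= addrC subrK.
have a2 n i : f1 (phi n i) = i by [].
have aK x : phi (f3 x) (f1 x) = x.
  by case: x => a b; rewrite /phi /f3 /f1 /= addrAC subrr add0r.
apply: vnull_ext => [t t' nt nt'|x c|e e0].
- by rewrite (dsumZD p1 p2) // (dsumZD a1 a2) //; ring.
- by rewrite (dsumZ_delta p1 p2 pK) (dsumZ_delta a1 a2 aK) subrr.
- exists e => // t nt te; apply: v_le_add; first exact: (dsumZ_le p1 p2).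
  by rewrite vN; apply: (dsumZ_le a1 a2).
Qed.

End Sums.

(** * Twisted powers *)

Section RealTwist.
Variables (R : realType) (q : nat).
Hypothesis q_gt1 : (1 < q)%N.

(** The counterpart of [qpow] on absolute values (see [v_qpow]). Real powers allow negative [i] and
    radii that are not values of [v]. *)
Definition pw (x : R) (i : int) : R := x `^ (q%:R ^ i).

Lemma qz_gt0 (i : int) : 0 < (q%:R : R) ^ i.
Proof. by apply: exprz_gt0; rewrite ltr0n; lia. Qed.

Lemma pw_ge0 x i : 0 <= pw x i. Proof. exact: powR_ge0. Qed.

Lemma pw_gt0 x i : 0 < x -> 0 < pw x i. Proof. exact: powR_gt0. Qed.

Lemma pwM x y i : 0 <= x -> 0 <= y -> pw (x * y) i = pw x i * pw y i.
Proof. exact: powRM. Qed.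

Lemma pw_pw x i j : pw (pw x i) j = pw x (i + j).
Proof.
rewrite /pw -powRrM expfzDr // pnatr_eq0; lia.
Qed.

Lemma pwr0 x : 0 <= x -> pw x 0 = x.
Proof. by move=> x0; rewrite /pw expr0z powRr1. Qed.

Lemma pw0r i : pw 0 i = 0.
Proof. by rewrite /pw powR0 // gt_eqF // qz_gt0. Qed.

Lemma pw1r i : pw 1 i = 1. Proof. by rewrite /pw powR1. Qed.

Lemma pwK x i : 0 <= x -> pw (pw x i) (- i) = x.
Proof. by move=> x0; rewrite pw_pw subrr pwr0. Qed.

Lemma pwVK x i : 0 <= x -> pw (pw x (- i)) i = x.
Proof. by move=> x0; rewrite pw_pw addrC subrr pwr0. Qed.

Lemma pwV x i : 0 <= x -> pw x^-1 i = (pw x i)^-1.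
Proof.
rewrite le_eqVlt => /predU1P[<-|x0]; first by rewrite invr0 pw0r invr0.
have px := pw_gt0 i x0; apply: (mulfI (lt0r_neq0 px)).
by rewrite -pwM ?invr_ge0 ?ltW // !divff ?pw1r ?gt_eqF.
Qed.

Lemma pw_le (x y : R) (i : int) : 0 <= x -> x <= y -> pw x i <= pw y i.
Proof.
move=> x0 xy; have y0 := le_trans x0 xy.
by apply: ge0_ler_powR => //; exact/ltW/qz_gt0.
Qed.

Lemma pw_lt (x y : R) (i : int) : 0 <= x -> x < y -> pw x i < pw y i.
Proof.
move=> x0 xy; have y0 := ltW (le_lt_trans x0 xy).
by apply: gt0_ltr_powR => //; exact: qz_gt0.
Qed.

Lemma pw_mono (c : R) (i j : int) : 1 <= c -> i <= j -> pw c i <= pw c j.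
Proof.
by move=> c1 ij; apply: ler_powR => //; rewrite ler_eXz2l // ltr1n.
Qed.

Lemma pw_anti (c : R) (i j : int) : 0 < c -> c <= 1 -> i <= j -> pw c j <= pw c i.
Proof.
move=> c0 c1 ij; have := @pw_mono c^-1 i j; rewrite !pwV ?(ltW c0) //.
by rewrite lef_pV2 ?posrE ?pw_gt0 //; apply=> //; rewrite invf_ge1.
Qed.

Lemma pw_smono (c : R) (i j : int) : 1 < c -> i < j -> pw c i < pw c j.
Proof.
move=> c1 ij; have c0 : 0 < c by lra.
rewrite lt_neqAle pw_mono ?(ltW ij) ?(ltW c1) // andbT; apply/eqP => h.
(* Raising a supposed equality to the power q^(-i) reduces it to the exponents 0 and j - i >= 1,
   where c < c^q decides. *)
have : pw c (i - i) < pw c (j - i).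
  rewrite subrr pwr0 ?(ltW c0) //; apply: (@lt_le_trans _ _ (pw c 1)); last first.
    by apply: pw_mono; lia || exact: ltW.
  rewrite /pw expr1z powR_mulrn ?(ltW c0) //.
  by rewrite -{1}[c]expr1 ltr_eXn2l.
by rewrite -!pw_pw h ltxx.
Qed.

Lemma pw_santi (c : R) (i j : int) : 0 < c -> c < 1 -> i < j -> pw c j < pw c i.
Proof.
move=> c0 c1 ij; have := @pw_smono c^-1 i j; rewrite !pwV ?(ltW c0) //.
by rewrite ltf_pV2 ?posrE ?pw_gt0 //; apply=> //; rewrite invf_gt1.
Qed.

Lemma pw_natX x i (N m : nat) : 0 <= x -> i + N%:Z = m%:Z ->
  pw x i ^+ (q ^ N) = x ^+ (q ^ m).
Proof.
move=> x0 iN; rewrite -!powR_mulrn ?pw_ge0 //.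
have E (n : nat) : (q ^ n)%:R = (q%:R : R) ^ n%:Z by rewrite natrX.
by rewrite !E -iN -/(pw (pw x i) N%:Z) -/(pw x (i + N%:Z)) pw_pw.
Qed.

(** Here q^n >= 2. This bound and [pw_le_sqrt] are the origin of the square and of the square root
    in [remainder_radius]. *)
Lemma pw_le_sqr (c : R) (n : int) : 0 <= c -> c <= 1 -> 0 < n -> pw c n <= c ^+ 2.
Proof.
rewrite le_eqVlt => /predU1P[<-|c0] c1 n0.
  by rewrite pw0r expr0n.
apply: (@le_trans _ _ (pw c 1)); first by apply: pw_anti => //; lia.
rewrite /pw expr1z powR_mulrn ?(ltW c0) //.
by apply: ler_wiXn2l; rewrite ?(ltW c0) // q_gt1.
Qed.

Lemma pw_le_sqrt (c : R) (n : int) : 1 <= c -> n < 0 -> pw c n <= Num.sqrt c.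
Proof.
move=> c1 n0; have c0 : 0 <= c by lra.
rewrite -[X in X <= _]ger0_norm ?pw_ge0 // -sqrtr_sqr ler_sqrt //.
have -> : pw c n ^+ 2 = pw (c ^+ 2) n by rewrite !expr2 pwM.
apply: (@le_trans _ _ (pw (pw c 1) n)).
  apply: pw_le; first exact: exprn_ge0.
  by rewrite /pw expr1z powR_mulrn //; apply: ler_weXn2l.
rewrite pw_pw -[X in _ <= X]pwr0 //; apply: pw_mono => //; lia.
Qed.

End RealTwist.

(** An identity between twisted powers is checked after raising both sides to the power q^N, where
    all exponents are natural numbers; in characteristic p this power map is injective. *)
Lemma int_shift_nat (i : int) : exists N m : nat, i + N%:Z = m%:Z.
Proof. by exists `|i|%N, (absz (i + `|i|%N%:Z)%R); lia. Qed.

(** * Polynomials with a root in a given disc *)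

Section PolynomialRoots.
Variables (R : realType) (C : closedFieldType) (v : nonarch_absval R C).

(** Each factor X - z with |z| > rho has its constant term strictly dominant at radius rho, and this
    property is preserved by products. *)
Lemma prod_large_roots_coef (rho : R) (r : seq C) : 0 < rho ->
  (forall z, z \in r -> rho < v z) ->
  let P := \prod_(z <- r) ('X - z%:P) in
  P`_0 != 0 /\ forall j, (0 < j)%N -> v P`_j * rho ^+ j < v P`_0.
Proof.
move=> r0; elim: r => [_|z r IHr hr] /=.
  rewrite big_nil; split=> [|j]; first by rewrite coef1 oner_eq0.
  by rewrite !coef1 v1; case: j => // j _; rewrite v0 mul0r ltr01.
have [x xr|P0 hP] := IHr; first by apply: hr; rewrite in_cons xr orbT.
rewrite big_cons; set P := \prod_(j <- r) _ in P0 hP *.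
have rz : rho < v z by apply: hr; rewrite mem_head.
have z0 : z != 0 by rewrite -(v_gt0 v); apply: lt_trans rz.
have vP0 : 0 < v P`_0 by rewrite v_gt0.
have E0 : (('X - z%:P) * P)`_0 = - (z * P`_0).
  by rewrite mulrBl coefB coefXM coefCM sub0r.
have vE0 : v (('X - z%:P) * P)`_0 = v z * v P`_0 by rewrite E0 vN absvalM.
split=> [|j j0]; first by rewrite E0 oppr_eq0 mulf_neq0.
rewrite vE0 mulrBl coefB coefXM coefCM gtn_eqF //.
have rj : 0 < rho ^+ j by exact: exprn_gt0.
rewrite -ltr_pdivlMr //; apply: v_ultraB; rewrite ltr_pdivlMr //.
  case: j j0 rj => // j _ _; rewrite /= exprSr mulrA.
  apply: (@le_lt_trans _ _ (v P`_0 * rho)).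
    rewrite ler_wpM2r ?(ltW r0) //.
    by case: j => [|j]; [rewrite expr0 mulr1|apply/ltW/hP].
  by rewrite mulrC ltr_pM2r.
by rewrite absvalM -mulrA ltr_pM2l ?v_gt0 // hP.
Qed.

(** Contrapositive of [prod_large_roots_coef], applied to the complete factorization of [P]. *)
Lemma ex_root_le (rho : R) (P : {poly C}) (j : nat) : 0 < rho -> (0 < j)%N ->
  P`_j != 0 -> v P`_0 <= v P`_j * rho ^+ j -> exists2 x, root P x & v x <= rho.
Proof.
move=> r0 j0 Pj hP; have [r Pr] := closed_field_poly_normal P.
have P0 : P != 0 by apply: contraNneq Pj => ->; rewrite coef0.
have [[x xr xrho]|nx] := pselect (exists2 x, x \in r & v x <= rho).
  by exists x => //; rewrite Pr rootZ ?lead_coef_eq0 // root_prod_XsubC.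
have [z zr|_ /(_ j j0)] := @prod_large_roots_coef rho r r0.
  by rewrite ltNge; apply/negP => zrho; apply: nx; exists z.
have l0 : 0 < v (lead_coef P) by rewrite v_gt0 lead_coef_eq0.
rewrite -(ltr_pM2l l0) mulrA -!absvalM -!coefZ -Pr => h.
by have := lt_le_trans h hP; rewrite ltxx.
Qed.

Lemma coef_sum_monomials (K : nat) (c : nat -> C) (e : nat -> nat) (j : nat) :
  injective e -> (j < K)%N -> (\sum_(i < K) c i *: 'X^(e i))`_(e j) = c j.
Proof.
move=> ei jK; rewrite coef_sum (bigD1 (Ordinal jK)) //= coefZ coefXn eqxx mulr1.
rewrite big1 ?addr0 // => i ij; rewrite coefZ coefXn.
by case: eqP => [/ei E|]; rewrite ?mulr0 //; move: ij; rewrite -val_eqE /= E eqxx.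
Qed.

End PolynomialRoots.

Section FractionalSeries.
Variables (R : realType) (C : closedFieldType) (v : nonarch_absval R C).
Variables (p k q : nat).
Hypotheses (pC : p \in [pchar C]) (k_gt0 : (0 < k)%N) (qE : q = (p ^ k)%N).
Hypothesis vc : v_complete v.

Local Notation qpow := (@qpow C q).
Local Notation pw := (@pw R q).
Local Notation F := (@calF R C v q).
Local Notation fcomp := (@fcomp R C v q).
Local Notation feval := (@feval R C v q).

Lemma q_gt1 : (1 < q)%N.
Proof.
by rewrite qE -(exp1n k) ltn_exp2r // prime_gt1 // (pcharf_prime pC).
Qed.

Let q1 : (1 < q)%N := q_gt1.

(** * The twisted powers of C as additive and multiplicative maps *)

Lemma qexp_inj (N : nat) : injective (fun x : C => x ^+ (q ^ N)).
Proof.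
move=> a b /= /eqP; rewrite -{1}(subrK b a) exprDn_pchar; last first.
  rewrite qE -expnM (eq_pnat _ (pcharf_eq pC)) pnatX pnat_id //.
  exact: pcharf_prime pC.
by rewrite -subr_eq0 addrK expf_eq0 subr_eq0 => /andP[_ /eqP].
Qed.

Lemma qpow_natX z i (N m : nat) : i + N%:Z = m%:Z ->
  qpow z i ^+ (q ^ N) = z ^+ (q ^ m).
Proof.
case: i => n iN.
  by rewrite /= -exprM -expnD; congr (_ ^+ (q ^ _)); lia.
have /(qpow_neg_unique _ _ pC qE) zE := erefl (qpow z (Negz n)).
have -> : N = (n.+1 + m)%N by lia.
by rewrite expnD exprM zE.
Qed.

Lemma qpow_uniq z i y (N m : nat) : i + N%:Z = m%:Z ->
  y ^+ (q ^ N) = z ^+ (q ^ m) -> qpow z i = y.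
Proof. by move=> iN yz; apply: (@qexp_inj N) => /=; rewrite (qpow_natX _ iN). Qed.

Lemma qpowM x y i : qpow (x * y) i = qpow x i * qpow y i.
Proof.
have [N [m iN]] := int_shift_nat i; apply: (qpow_uniq iN).
by rewrite !exprMn !(qpow_natX _ iN).
Qed.

Lemma qpowD i : {morph qpow^~ i : x y / x + y}.
Proof.
move=> x y; have [N [m iN]] := int_shift_nat i; apply: (qpow_uniq iN).
have pq n : [pchar C].-nat (q ^ n)%N.
  rewrite qE -expnM (eq_pnat _ (pcharf_eq pC)) pnatX pnat_id //.
  exact: pcharf_prime pC.
by rewrite !exprDn_pchar // !(qpow_natX _ iN).
Qed.

Lemma qpow_qpow x i j : qpow (qpow x i) j = qpow x (i + j).
Proof.
have [N [m iN]] := int_shift_nat i; have [M [n jM]] := int_shift_nat j.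
symmetry; apply: (@qpow_uniq _ _ _ (M + N) (m + n)); first by lia.
by rewrite expnD exprM (qpow_natX _ jM) exprAC (qpow_natX _ iN) -exprM -expnD.
Qed.

Lemma qpow_0 x : qpow x 0 = x. Proof. by rewrite /qpow /= expn0 expr1. Qed.

Lemma qpow0r i : qpow 0 i = 0.
Proof. by apply: (addIr (qpow 0 i)); rewrite -qpowD !add0r. Qed.

Lemma qpow1r i : qpow 1 i = 1.
Proof.
have [N [m iN]] := int_shift_nat i; apply: (qpow_uniq iN); by rewrite !expr1n.
Qed.

Lemma qpowN x i : qpow (- x) i = - qpow x i.
Proof. by apply: (addrI (qpow x i)); rewrite -qpowD !subrr qpow0r. Qed.

Lemma qpow_eq0 x i : (qpow x i == 0) = (x == 0).
Proof.
apply/eqP/eqP => [h|->]; last exact: qpow0r.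
by rewrite -(qpow_0 x) -(subrr i) -qpow_qpow h qpow0r.
Qed.

Lemma qpowV x i : qpow x^-1 i = (qpow x i)^-1.
Proof.
have [->|x0] := eqVneq x 0; first by rewrite invr0 qpow0r invr0.
have qx0 : qpow x i != 0 by rewrite qpow_eq0.
by apply: (mulfI qx0); rewrite -qpowM !divff // qpow1r.
Qed.

Lemma v_qpow x i : v (qpow x i) = pw (v x) i.
Proof.
have [N [m iN]] := int_shift_nat i.
have N0 : (0 < q ^ N)%N by rewrite expn_gt0; have := q_gt1; lia.
apply/eqP; rewrite -(eqrXn2 N0) ?absval_ge0 ?pw_ge0 //.
by rewrite -vX (qpow_natX _ iN) (pw_natX q_gt1 _ iN) ?absval_ge0 // vX.
Qed.

Lemma qpow_continuous (i : int) (e : R) : 0 < e ->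
  exists2 d, 0 < d & forall x, v x <= d -> v (qpow x i) <= e.
Proof.
move=> e0; exists (pw e (- i)) => [|x xd]; first exact: pw_gt0.
rewrite v_qpow -[e](pwVK q_gt1 i) ?(ltW e0) //; apply: (pw_le q_gt1) => //.
exact: absval_ge0.
Qed.

(** * Gauss norms and composition *)

Definition wt (f : int -> C) (rho : R) (n : int) : R := v (f n) * pw rho n.

Definition dominant (f : int -> C) (rho : R) (i : int) : Prop :=
  forall n, wt f rho n <= wt f rho i.

(* Junk value [wt f rho 0] when the maximum is not attained. *)
Definition gaussnorm (f : int -> C) (rho : R) : R :=
  wt f rho (xget 0 [set i | dominant f rho i]).

Lemma wt_ge0 f rho n : 0 <= wt f rho n.
Proof. by rewrite mulr_ge0 ?absval_ge0 ?pw_ge0. Qed.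

Lemma wt_gt0 f rho n : 0 < rho -> f n != 0 -> 0 < wt f rho n.
Proof. by move=> r0 fn; rewrite mulr_gt0 ?v_gt0 ?pw_gt0. Qed.

Lemma wt_neq0 f rho n : 0 < wt f rho n -> f n != 0.
Proof. by apply: contraTneq => fn; rewrite /wt fn v0 mul0r ltxx. Qed.

Lemma wt_le f rho rho' n : 0 <= rho -> rho <= rho' -> wt f rho n <= wt f rho' n.
Proof. by move=> r0 rr; rewrite ler_wpM2l ?absval_ge0 // pw_le. Qed.

Lemma wt_eval f z n : v (f n * qpow z n) = wt f (v z) n.
Proof. by rewrite absvalM v_qpow. Qed.

Lemma wt_scale f rho c n : 0 <= rho -> 0 <= c ->
  wt f (rho * c) n = wt f rho n * pw c n.
Proof. by move=> r0 c0; rewrite /wt pwM // mulrA. Qed.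

Lemma wtN f rho n : wt (fun i => - f i) rho n = wt f rho n.
Proof. by rewrite /wt vN. Qed.

Lemma wtD_le f g rho n B : 0 < rho -> wt f rho n <= B -> wt g rho n <= B ->
  wt (fun i => f i + g i) rho n <= B.
Proof.
move=> r0; rewrite /wt -!ler_pdivlMr ?pw_gt0 //; exact: v_le_add.
Qed.

(** The powers of an element with [v x > 1] are unbounded by Bernoulli's inequality; without such an
    element, inversion excludes nonzero elements of absolute value below 1. *)
Lemma v_trivialVunbounded (r : R) :
  (exists x, r <= v x) \/ (forall x, v x < 1 -> x = 0).
Proof.
have [[x x1]|nx] := pselect (exists x, 1 < v x); last first.
  right=> x x1; apply/eqP; apply/negP => /negP x0; apply: nx; exists x^-1.
  by rewrite vV invf_gt1 // v_gt0.
left; pose d := v x - 1; have d0 : 0 < d by rewrite subr_gt0.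
have bern n : 1 + d *+ n <= v (x ^+ n).
  elim: n => [|n IHn]; first by rewrite expr0 v1 mulr0n addr0.
  rewrite exprS absvalM; apply: (@le_trans _ _ (v x * (1 + d *+ n))).
    have -> : v x = 1 + d by rewrite /d addrC subrK.
    have : 0 <= d * (d *+ n) by rewrite mulr_ge0 ?mulrn_wge0 // ltW.
    by rewrite mulrS; move: (d *+ n) => a; lra.
  by rewrite ler_wpM2l ?absval_ge0.
have [n rn] : exists n, r <= d *+ n.
  exists (Num.bound (`|r| / d)).
  have := archi_boundP (divr_ge0 (normr_ge0 r) (ltW d0)).
  rewrite ltr_pdivrMr // mulrC mulr_natr => /ltW; apply: le_trans; exact: ler_norm.
by exists (x ^+ n); apply: le_trans (bern n); rewrite ler_wpDl.
Qed.

(* If [v] is trivial, [rho] may exceed all the values of [v]; in that case [f] has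
   finite support. *)
Lemma calFP f : F f <-> forall rho, 0 < rho -> rnull (wt f rho).
Proof.
split=> [fF rho r0|fF z].
  have ev_null z : rnull (wt f (v z)).
    have /(vnull_sumZ_cvg vc) := fF z.
    by apply: rnull_le => n; rewrite wt_eval.
  have [[x rx]|triv] := v_trivialVunbounded rho.
    by apply: rnull_le (ev_null x) => n; apply: wt_le => //; exact: ltW.
  move=> e e0; have [r hr] := ev_null 1 1 ltr01.
  exists r => n /hr; rewrite v1 /wt pw1r mulr1 => /triv ->.
  by rewrite v0 mul0r.
apply/(vnull_sumZ_cvg vc); have [->|z0] := eqVneq z 0.
  by move=> e e0; exists [::] => n _; rewrite qpow0r mulr0 v0.
by apply: rnull_le (fF (v z) _) => [n|]; rewrite ?wt_eval ?v_gt0.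
Qed.

Lemma eval_vnull f z : F f -> vnull v (fun n => f n * qpow z n).
Proof. by move=> fF; apply/(vnull_sumZ_cvg vc)/fF. Qed.

Lemma calF_finsupp f (r : seq int) : (forall n, n \notin r -> f n = 0) -> F f.
Proof.
move=> fr; apply/calFP => rho r0 e e0; exists r => n /fr fn.
by rewrite /wt fn v0 mul0r.
Qed.

Lemma calF_le f g : F g -> (forall n, v (f n) <= v (g n)) -> F f.
Proof.
move=> /calFP gF fg; apply/calFP => rho r0; apply: rnull_le (gF rho r0) => n.
by rewrite ler_wpM2r ?pw_ge0.
Qed.

Lemma calFN f : F f -> F (fun n => - f n).
Proof. by move=> fF; apply: calF_le fF _ => n; rewrite vN. Qed.

Lemma calFD f g : F f -> F g -> F (fun n => f n + g n).
Proof.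
move=> /calFP fF /calFP gF; apply/calFP => rho r0 e e0.
have [r hr] := fF rho r0 e e0; have [s hs] := gF rho r0 e e0.
exists (r ++ s) => i; rewrite mem_cat negb_or => /andP[/hr ir /hs si].
apply: (@le_lt_trans _ _ (Num.max (wt f rho i) (wt g rho i))).
  by apply: wtD_le => //; rewrite le_max lexx ?orbT.
by rewrite gt_max ir.
Qed.

Lemma calFB f g : F f -> F g -> F (fun n => f n - g n).
Proof. by move=> fF gF; apply: calFD => //; exact: calFN. Qed.

Lemma ex_dominant f rho : F f -> 0 < rho -> exists i, dominant f rho i.
Proof.
move=> /calFP fF r0; apply: (rnull_argmax 0) => [i|]; first exact: wt_ge0.
exact: fF.
Qed.

Lemma gaussnorm_dominant f rho i : dominant f rho i -> gaussnorm f rho = wt f rho i.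
Proof.
move=> di; have dx : dominant f rho (xget 0 [set i | dominant f rho i]).
  by apply: (@xgetPex _ 0 [set i | dominant f rho i]); exists i.
by apply/eqP; rewrite /gaussnorm eq_le dx di.
Qed.

Lemma wt_le_gaussnorm f rho n : F f -> 0 < rho -> wt f rho n <= gaussnorm f rho.
Proof.
move=> fF r0; have [i di] := ex_dominant fF r0.
by rewrite (gaussnorm_dominant di).
Qed.

Lemma gaussnorm_le f rho B : F f -> 0 < rho -> (forall n, wt f rho n <= B) ->
  gaussnorm f rho <= B.
Proof.
move=> fF r0 h; have [i di] := ex_dominant fF r0.
by rewrite (gaussnorm_dominant di).
Qed.

Lemma gaussnorm_ge0 f rho : 0 <= gaussnorm f rho. Proof. exact: wt_ge0. Qed.

Lemma gaussnorm_gt0 f rho n : F f -> 0 < rho -> f n != 0 -> 0 < gaussnorm f rho.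
Proof.
move=> fF r0 fn; apply: lt_le_trans (wt_le_gaussnorm n fF r0).
exact: wt_gt0.
Qed.

Lemma dominantP f rho i : F f -> 0 < rho ->
  dominant f rho i <-> wt f rho i = gaussnorm f rho.
Proof.
move=> fF r0; split=> [/gaussnorm_dominant ->//|wi n]; rewrite wi; exact: wt_le_gaussnorm.
Qed.

Lemma gaussnorm_mono f rho rho' : F f -> 0 < rho -> rho <= rho' ->
  gaussnorm f rho <= gaussnorm f rho'.
Proof.
move=> fF r0 rr; apply: gaussnorm_le => // n.
apply: le_trans (wt_le_gaussnorm n fF (lt_le_trans r0 rr)).
by apply: wt_le => //; exact: ltW.
Qed.

Lemma gaussnorm_smono f rho rho' n : F f -> f n != 0 -> 0 < rho -> rho < rho' ->
  gaussnorm f rho < gaussnorm f rho'.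
Proof.
move=> fF fn r0 rr; have [i di] := ex_dominant fF r0.
have fi : f i != 0.
  by apply: (@wt_neq0 _ rho); rewrite -(gaussnorm_dominant di); exact: gaussnorm_gt0 fn.
rewrite (gaussnorm_dominant di).
apply: lt_le_trans (wt_le_gaussnorm i fF (lt_trans r0 rr)).
by rewrite /wt ltr_pM2l ?v_gt0 // pw_lt // ltW.
Qed.

Lemma gaussnorm_small f e : F f -> 0 < e ->
  exists2 d, 0 < d & forall rho, 0 < rho -> rho <= d -> gaussnorm f rho <= e.
Proof.
move=> fF e0; have /calFP/(_ 1 ltr01 e e0)[r hr] := fF.
have [d d0 hd] : exists2 d : R, 0 < d <= 1 &
    forall n, n \in r -> wt f d n <= e.
  elim: r {hr} => [|m r [d /andP[d0 d1] hd]]; first by exists 1 => //; rewrite ltr01 lexx.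
  have fm1 : 0 < v (f m) + 1 by rewrite ltr_wpDl ?absval_ge0.
  have em : 0 < e / (v (f m) + 1) by rewrite divr_gt0.
  (* At this radius the term of index [m] weighs at most [e]; the summand 1 avoids division by zero
     when [f m] vanishes. *)
  pose d' := pw (e / (v (f m) + 1)) (- m).
  have d'0 : 0 < d' by apply: pw_gt0.
  have dd0 : 0 < Num.min d d' by rewrite lt_min d0.
  exists (Num.min d d') => [|n]; first by rewrite dd0 ge_min d1.
  rewrite in_cons => /predU1P[->|/hd]; last first.
    by apply: le_trans; apply: wt_le; [exact: ltW|rewrite ge_min lexx].
  apply: (@le_trans _ _ (wt f d' m)).
    by apply: wt_le; [exact: ltW|rewrite ge_min lexx orbT].
  rewrite /wt (pwVK q1 _ (ltW em)) mulrA ler_pdivrMr // mulrC.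
  by rewrite ler_pM2l // lerDl.
case/andP: d0 => d0 d1; exists d => // rho r0 rd; apply: gaussnorm_le => // n.
have [/hd|/hr/ltW] := boolP (n \in r); apply: le_trans; apply: wt_le;
  rewrite ?(ltW r0) //; exact: le_trans d1.
Qed.

(** The identity (|b| rho^(q^j))^(q^i) = |b|^(q^i) rho^(q^(i+j)) with j = n - i: the weight of a
    term of [g] becomes the radius at which a term of [f] is weighed. *)
Lemma comp_term f g rho n i : 0 <= rho ->
  v (f i * qpow (g (n - i)) i) * pw rho n = v (f i) * pw (wt g rho (n - i)) i.
Proof.
move=> r0; rewrite absvalM v_qpow /wt pwM ?absval_ge0 ?pw_ge0 //.
by rewrite (pw_pw q1) subrK mulrA.
Qed.

Lemma comp_vnull f g n : F f -> F g -> vnull v (fun i => f i * qpow (g (n - i)) i).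
Proof.
by move=> fF gF; apply/(vnull_sumZ_cvg vc); apply: (@fcomp_cvg _ _ v q p k).
Qed.

Lemma comp_null f g rho : F f -> F g -> 0 < rho ->
  rnull (fun x : int * int => v (f x.1) * pw (wt g rho x.2) x.1).
Proof.
move=> fF gF r0 e e0.
(* This radius bounds all weights of [g] and stays positive for g = 0. It settles all but finitely
   many [i], uniformly in [j]; for each remaining [i] the nullity of [g] is used. *)
have Y0 : 0 < gaussnorm g rho + 1 by rewrite ltr_wpDl ?gaussnorm_ge0.
have /calFP/(_ _ Y0 e e0)[r hr] := fF.
have [s hs] : exists s : seq int, forall i j, i \in r -> j \notin s ->
    v (f i) * pw (wt g rho j) i < e.
  elim: r {hr} => [|m r [s hs]]; first by exists [::].
  have fm1 : 0 < v (f m) + 1 by rewrite ltr_wpDl ?absval_ge0.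
  have em : 0 < e / (v (f m) + 1) by rewrite divr_gt0.
  have /calFP/(_ _ r0 _ (pw_gt0 q (- m) em))[s' hs'] := gF.
  exists (s' ++ s) => i j; rewrite mem_cat negb_or in_cons.
  move=> /predU1P[->|ir] /andP[js' js]; last exact: hs.
  apply: (@le_lt_trans _ _ ((v (f m) + 1) * pw (wt g rho j) m)).
    by rewrite ler_wpM2r ?pw_ge0 // lerDl.
  rewrite mulrC -ltr_pdivlMr // -[ltRHS](pwVK q1 m) ?(ltW em) //.
  by apply: pw_lt => //; [exact: wt_ge0|exact: hs'].
exists [seq (i, j) | i <- r, j <- s] => -[i j] /= ij.
have [ir|/hr] := boolP (i \in r).
  apply: hs => //; apply: contra ij => js; apply/allpairsP; by exists (i, j).
apply: le_lt_trans; rewrite ler_wpM2l ?absval_ge0 // pw_le ?wt_ge0 //.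
by apply: le_trans (wt_le_gaussnorm j gF r0) _; rewrite lerDl.
Qed.

Lemma sumZ_wt_le u c B : vnull v u -> 0 < c -> (forall i, v (u i) * c <= B) ->
  v (sumZ v u) * c <= B.
Proof.
move=> nu c0 uB; rewrite -ler_pdivlMr //; apply: sumZ_le => // i.
by rewrite ler_pdivlMr.
Qed.

Lemma fcomp_wt_le f g rho Y n : F f -> F g -> 0 < rho -> 0 < Y ->
  (forall j, wt g rho j <= Y) -> wt (fcomp f g) rho n <= gaussnorm f Y.
Proof.
move=> fF gF r0 Y0 gY; apply: sumZ_wt_le => [||i]; first exact: comp_vnull.
  exact: pw_gt0.
rewrite comp_term ?(ltW r0) //; apply: le_trans (wt_le_gaussnorm i fF Y0).
by rewrite ler_wpM2l ?absval_ge0 // pw_le ?wt_ge0.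
Qed.

Lemma calF_fcomp f g : F f -> F g -> F (fcomp f g).
Proof.
move=> fF gF; apply/calFP => rho r0 e e0.
have [r hr] := comp_null fF gF r0 (divr_gt0 e0 (ltr0Sn _ 1)).
exists (map (fun x : int * int => x.1 + x.2) r) => n nr.
apply: (@le_lt_trans _ _ (e / 2)); last by lra.
apply: sumZ_wt_le => [||i]; [exact: comp_vnull|exact: pw_gt0|].
rewrite comp_term ?(ltW r0) //; apply/ltW/(hr (i, n - i)).
apply: contra nr => xr; apply/mapP; exists (i, n - i) => //=.
by rewrite addrC subrK.
Qed.

Lemma feval_fcomp f g z : F f -> F g -> feval (fcomp f g) z = feval f (feval g z).
Proof.
move=> fF gF; pose t (x : int * int) := f x.1 * qpow (g x.2 * qpow z x.2) x.1.
have nt : vnull v t.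
  have [zE|z0] := eqVneq z 0.
    move=> e e0; exists [::] => x _.
    by rewrite /t zE qpow0r mulr0 qpow0r mulr0 v0.
  apply: rnull_le (comp_null fF gF (_ : 0 < v z)) => [x|]; last by rewrite v_gt0.
  by rewrite /t absvalM v_qpow wt_eval.
(* Summing [t] by rows gives f(g(z)), and by antidiagonals the value of the composed series. *)
transitivity (dsumZ v (fun n i => (i, n - i)) t); last first.
  rewrite -dsumZ_antidiagonal //; congr sumZ; apply/funext => i.
  have nu := eval_vnull z gF.
  rewrite /feval (sumZ_map vc (qpowD i) _ nu); last first.
    exact: qpow_continuous.
  rewrite sumZ_mull //; apply: (vnull_map (phi := qpow^~ i) _ nu).
  exact: qpow_continuous.
congr sumZ; apply/funext => n; rewrite mulrC sumZ_mull //; last exact: comp_vnull.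
congr sumZ; apply/funext => i.
by rewrite /t /= qpowM qpow_qpow subrK mulrC mulrA.
Qed.

Lemma fevalD f : F f -> {morph feval f : x y / x + y}.
Proof.
move=> fF x y; rewrite /feval -sumZD //; [|exact: eval_vnull..].
by congr sumZ; apply/funext => n; rewrite qpowD mulrDr.
Qed.

Lemma feval0 f : F f -> feval f 0 = 0.
Proof. by move=> fF; apply: (addIr (feval f 0)); rewrite -fevalD // !add0r. Qed.

Lemma fevalB f x y : F f -> feval f (x - y) = feval f x - feval f y.
Proof. by move=> fF; apply: (addIr (feval f y)); rewrite -fevalD // !subrK. Qed.

Lemma feval_addl f g z : F f -> F g ->
  feval (fun n => f n + g n) z = feval f z + feval g z.
Proof.
move=> fF gF; rewrite /feval -sumZD //; [|exact: eval_vnull..].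
by congr sumZ; apply/funext => n; rewrite mulrDl.
Qed.

Lemma v_feval_le f z B : F f -> (forall n, wt f (v z) n <= B) -> v (feval f z) <= B.
Proof.
by move=> fF h; apply: sumZ_le => [//||n]; [exact: eval_vnull|rewrite wt_eval].
Qed.

Lemma fcomp_subl f f' g n : F f -> F f' -> F g ->
  fcomp (fun i => f i - f' i) g n = fcomp f g n - fcomp f' g n.
Proof.
move=> fF f'F gF; rewrite /fcomp sumZN //; last exact: comp_vnull.
rewrite -sumZD //; [|exact: comp_vnull|]; last first.
  by apply: rnull_le (comp_vnull n f'F gF) => i; rewrite vN.
by congr sumZ; apply/funext => i; rewrite mulrBl.
Qed.

(** * Dominant indices and Gauss's lemma *)

Lemma ex_first_dominant f rho n : F f -> 0 < rho -> f n != 0 ->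
  exists2 i, dominant f rho i & forall m, m < i -> wt f rho m < gaussnorm f rho.
Proof.
move=> fF r0 fn; have /calFP/(_ _ r0) nf := fF.
have [N hN] := (rnull_intP _).1 nf _ (gaussnorm_gt0 fF r0 fn).
have [||i di hi] := @int_ex_min (dominant f rho) N.
- move=> m /(dominantP _ fF r0) dm; rewrite leqNgt; apply/negP => /ltnW/hN.
  by rewrite dm ltxx.
- exact: ex_dominant.
exists i => // m mi; rewrite lt_neqAle wt_le_gaussnorm // andbT; apply/eqP.
by move=> /(dominantP _ fF r0)/hi; rewrite leNgt mi.
Qed.

Lemma ex_last_dominant f rho n : F f -> 0 < rho -> f n != 0 ->
  exists2 i, dominant f rho i & forall m, i < m -> wt f rho m < gaussnorm f rho.
Proof.
move=> fF r0 fn; have /calFP/(_ _ r0) nf := fF.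
have [N hN] := (rnull_intP _).1 nf _ (gaussnorm_gt0 fF r0 fn).
have [||i di hi] := @int_ex_max (dominant f rho) N.
- move=> m /(dominantP _ fF r0) dm; rewrite leqNgt; apply/negP => /ltnW/hN.
  by rewrite dm ltxx.
- exact: ex_dominant.
exists i => // m mi; rewrite lt_neqAle wt_le_gaussnorm // andbT; apply/eqP.
by move=> /(dominantP _ fF r0)/hi; rewrite leNgt mi.
Qed.

(** Under the last hypothesis the summand of index [i] is strictly the largest in the coefficient i
    + j, so [sumZ_dominant] evaluates that coefficient. *)
Lemma fcomp_wt_dominant f g rho i j : F f -> F g -> 0 < rho ->
  f i != 0 -> g j != 0 -> dominant f (gaussnorm g rho) i -> dominant g rho j ->
  (forall i', i' != i -> wt f (gaussnorm g rho) i' < gaussnorm f (gaussnorm g rho) \/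
     wt g rho (i + j - i') < gaussnorm g rho) ->
  wt (fcomp f g) rho (i + j) = gaussnorm f (gaussnorm g rho).
Proof.
move=> fF gF r0 fi gj di dj hs; set Y := gaussnorm g rho in di hs *.
have Y0 : 0 < Y by exact: gaussnorm_gt0 gj.
have P0 := pw_gt0 q (i + j) r0.
have ti : v (f i * qpow (g (i + j - i)) i) * pw rho (i + j) = gaussnorm f Y.
  rewrite (comp_term _ _ _ _ (ltW r0)) (gaussnorm_dominant di).
  by rewrite (addrC i j) addrK -(gaussnorm_dominant dj).
rewrite /wt /fcomp (@sumZ_dominant _ _ _ vc _ i) ?ti //; first exact: comp_vnull.
move=> i' i'i; rewrite -(ltr_pM2r P0) ti (comp_term _ _ _ _ (ltW r0)).
have [h|h] := hs _ i'i.
  apply: le_lt_trans h; rewrite [leRHS]/wt; apply: ler_wpM2l; first exact: absval_ge0.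
  by apply: (pw_le q1); [exact: wt_ge0|exact: wt_le_gaussnorm].
have [->|fi'] := eqVneq (f i') 0; first by rewrite v0 mul0r; exact: gaussnorm_gt0 fi.
apply: lt_le_trans (wt_le_gaussnorm i' fF Y0).
by rewrite /wt ltr_pM2l ?v_gt0 // pw_lt // wt_ge0.
Qed.

Lemma dominant_neq0 f rho n i : 0 < rho -> f n != 0 -> dominant f rho i -> f i != 0.
Proof.
move=> r0 fn di; apply: (@wt_neq0 _ rho); apply: lt_le_trans (di n).
exact: wt_gt0.
Qed.

Lemma gaussnorm_fcomp f g rho n : F f -> F g -> 0 < rho -> g n != 0 ->
  gaussnorm (fcomp f g) rho = gaussnorm f (gaussnorm g rho).
Proof.
move=> fF gF r0 gn; have Y0 : 0 < gaussnorm g rho by exact: gaussnorm_gt0 gn.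
have cF := calF_fcomp fF gF.
apply/eqP; rewrite eq_le; apply/andP; split.
  by apply: gaussnorm_le => // m; apply: fcomp_wt_le => // j; exact: wt_le_gaussnorm.
have [[m fm]|f0] := pselect (exists m, f m != 0); last first.
  apply: (@le_trans _ _ 0); last exact: gaussnorm_ge0.
  apply: gaussnorm_le => // m.
  rewrite /wt; suff -> : f m = 0 by rewrite v0 mul0r.
  by apply/eqP; apply/negP => /negP fm; apply: f0; exists m.
(* For first dominant indices i and j, any other splitting of i + j has one part below i or below j,
   and there the weight is strictly smaller. *)
have [i di hi] := ex_first_dominant fF Y0 fm.
have [j dj hj] := ex_first_dominant gF r0 gn.
rewrite -(fcomp_wt_dominant fF gF r0 _ _ di dj); first exact: wt_le_gaussnorm.
- exact: dominant_neq0 fm di.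
- exact: dominant_neq0 gn dj.
by move=> i'; case: (ltgtP i' i) => // h _; [left; exact: hi|right; apply: hj; lia].
Qed.

Lemma dominant_fcomp_first f g rho i j n m : F f -> F g -> 0 < rho ->
  f m != 0 -> g n != 0 -> dominant f (gaussnorm g rho) i -> dominant g rho j ->
  (forall l, l < i -> wt f (gaussnorm g rho) l < gaussnorm f (gaussnorm g rho)) ->
  (forall l, l < j -> wt g rho l < gaussnorm g rho) ->
  dominant (fcomp f g) rho (i + j).
Proof.
move=> fF gF r0 fm gn di dj hi hj.
have Y0 : 0 < gaussnorm g rho by exact: gaussnorm_gt0 gn.
apply/dominantP => //; first exact: calF_fcomp.
rewrite (gaussnorm_fcomp fF gF r0 gn) fcomp_wt_dominant //.
- exact: dominant_neq0 fm di.
- exact: dominant_neq0 gn dj.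
by move=> i'; case: (ltgtP i' i) => // h _; [left; exact: hi|right; apply: hj; lia].
Qed.

Lemma dominant_fcomp_last f g rho i j n m : F f -> F g -> 0 < rho ->
  f m != 0 -> g n != 0 -> dominant f (gaussnorm g rho) i -> dominant g rho j ->
  (forall l, i < l -> wt f (gaussnorm g rho) l < gaussnorm f (gaussnorm g rho)) ->
  (forall l, j < l -> wt g rho l < gaussnorm g rho) ->
  dominant (fcomp f g) rho (i + j).
Proof.
move=> fF gF r0 fm gn di dj hi hj.
have Y0 : 0 < gaussnorm g rho by exact: gaussnorm_gt0 gn.
apply/dominantP => //; first exact: calF_fcomp.
rewrite (gaussnorm_fcomp fF gF r0 gn) fcomp_wt_dominant //.
- exact: dominant_neq0 fm di.
- exact: dominant_neq0 gn dj.
by move=> i'; case: (ltgtP i' i) => // h _; [right; apply: hj; lia|left; exact: hi].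
Qed.

(** Enlarging the radius by a factor c > 1 multiplies the weight of index n by c^(q^n), which
    increases with n. *)
Lemma dominant_mono f s rho i j n : f n != 0 -> 0 < s -> s < rho ->
  dominant f s i -> dominant f rho j -> i <= j.
Proof.
move=> fn s0 sr di dj; rewrite leNgt; apply/negP => ji.
have c1 : 1 < rho / s by rewrite ltr_pdivlMr // mul1r.
have rE : rho = s * (rho / s) by rewrite mulrC divfK ?gt_eqF.
have c0 : 0 <= rho / s by lra.
have := dj i; rewrite rE !wt_scale ?(ltW s0) // leNgt => /negP; apply.
apply: (@le_lt_trans _ _ (wt f s i * pw (rho / s) j)).
  by rewrite ler_wpM2r ?pw_ge0.
by rewrite ltr_pM2l ?pw_smono // wt_gt0 // (dominant_neq0 s0 fn di).
Qed.

(** * Surjectivity and zeros *)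

Lemma wt_at_radius g i c : 0 <= c -> g i != 0 -> wt g (pw (c / v (g i)) (- i)) i = c.
Proof.
move=> c0 gi; rewrite /wt (pwVK q1) ?divr_ge0 ?absval_ge0 //.
by rewrite mulrC divfK // v_eq0.
Qed.

Lemma pw_wt g rho i j : pw (wt g rho i) j = pw (v (g i)) j * pw rho (i + j).
Proof. by rewrite /wt pwM ?absval_ge0 ?pw_ge0 // (pw_pw q1). Qed.

Lemma feval_finite f (i0 : int) (K : nat) z :
  (forall n, n < i0 \/ i0 + K%:Z <= n -> f n = 0) ->
  feval f z = \sum_(j < K) f (i0 + j%:Z) * qpow z (i0 + j%:Z).
Proof.
move=> f0; pose r := [seq i0 + j%:Z | j <- iota 0 K].
rewrite /feval (@sumZ_finite _ _ _ vc r).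
- rewrite big_map -(big_mkord xpredT (fun j : nat => f (i0 + j%:Z) * qpow z (i0 + j%:Z))).
  by rewrite /index_iota subn0.
- by rewrite map_inj_uniq ?iota_uniq // => a b /addrI[].
move=> n nr; rewrite f0 ?mul0r //.
have [h|h] := ltP n i0; first by left.
right; rewrite leNgt; apply/negP => h'; move/negP: nr; apply.
by apply/mapP; exists (absz (n - i0)%R); [rewrite mem_iota; lia|lia].
Qed.

(* Raising the finite sum to the power q^(-i0) makes it a polynomial. *)
Lemma feval_finite_poly f (i0 : int) (K : nat) z :
  (forall n, n < i0 \/ i0 + K%:Z <= n -> f n = 0) ->
  qpow (feval f z) (- i0) =
    (\sum_(j < K) qpow (f (i0 + j%:Z)) (- i0) *: 'X^(q ^ j)).[z].
Proof.
move=> f0; rewrite (feval_finite z f0) horner_sum.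
rewrite (big_morph (qpow^~ (- i0)) (qpowD _) (qpow0r _)).
apply: eq_bigr => j _; rewrite qpowM qpow_qpow.
by rewrite hornerZ hornerXn (addrC i0) addrK.
Qed.

(** The truncated equation is solved exactly as a polynomial equation; the discarded terms,
    evaluated at the root, make up the error. *)
Lemma feval_approx_sol g w i rho : F g -> g i != 0 -> w != 0 -> 0 < rho ->
  wt g rho i = v w -> exists2 z, v z <= rho & v (feval g z - w) <= v w / 2.
Proof.
move=> gF gi w0 r0 wi; have vw0 : 0 < v w by rewrite v_gt0.
have /calFP/(_ _ r0)/rnull_intP/(_ _ (divr_gt0 vw0 (ltr0Sn _ 1)))[N hN] := gF.
(* Beyond [N] the terms weigh less than [v w / 2]; adding the absolute value of [i] keeps the term
   of index [i], whose weight forces a root of size at most [rho]. *)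
pose M := (N + `|i|)%N; pose g1 n := if (`|n| <= M)%N then g n else 0.
pose g2 n := if (`|n| <= M)%N then 0 else g n.
have gE : g = fun n => g1 n + g2 n.
  by apply/funext => n; rewrite /g1 /g2; case: ifP; rewrite ?addr0 ?add0r.
have g1F : F g1.
  by apply: (calF_le gF) => n; rewrite /g1; case: ifP; rewrite ?v0 ?absval_ge0.
have g2F : F g2.
  by apply: (calF_le gF) => n; rewrite /g2; case: ifP; rewrite ?v0 ?absval_ge0.
pose i0 : int := - M%:Z; pose K := (M + M).+1.
have g10 n : n < i0 \/ i0 + K%:Z <= n -> g1 n = 0.
  by move=> h; rewrite /g1 ifF //; apply/negbTE; rewrite -ltnNge /i0 /K in h *; lia.
pose P := \sum_(j < K) qpow (g1 (i0 + j%:Z)) (- i0) *: 'X^(q ^ j) - (qpow w (- i0))%:P.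
pose j := absz (i - i0)%R.
have jE : i0 + j%:Z = i by rewrite /j /i0 /M; lia.
have jK : (j < K)%N by rewrite /j /i0 /K /M; lia.
have qj0 (l : nat) : (0 < q ^ l)%N by rewrite expn_gt0; lia.
have qinj : injective (fun l => (q ^ l)%N) by exact: expnI.
have g1i : g1 i = g i by rewrite /g1 ifT // /M; lia.
have Pj : P`_(q ^ j) = qpow (g i) (- i0).
  rewrite coefB (coef_sum_monomials (fun l => qpow (g1 (i0 + l%:Z)) (- i0)) qinj jK).
  by rewrite jE g1i coefC gtn_eqF // subr0.
have P0 : P`_0 = - qpow w (- i0).
  rewrite coefB coef_sum big1 ?sub0r ?coefC ?eqxx // => l _.
  by rewrite coefZ coefXn ltn_eqF ?mulr0.
have [||z Pz zr] := @ex_root_le _ _ v rho P (q ^ j) r0 (qj0 _).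
- by rewrite Pj qpow_eq0.
- rewrite P0 Pj vN !v_qpow -wi pw_wt.
  have -> : i - i0 = j%:Z by rewrite -jE addrAC subrr add0r.
  have := @pw_natX _ _ q1 rho 0 j j (ltW r0).
  have := @pw_natX _ _ q1 rho j%:Z 0 j (ltW r0); rewrite addr0 expn0 expr1.
  by move=> /(_ erefl) ->.
exists z => //.
have g1z : feval g1 z = w.
  have : qpow (feval g1 z - w) (- i0) = 0.
    rewrite qpowD qpowN (feval_finite_poly z g10).
    by move/rootP: Pz; rewrite hornerD hornerN hornerC.
  by move/eqP; rewrite qpow_eq0 subr_eq0 => /eqP.
rewrite gE feval_addl // g1z addrAC subrr add0r.
apply: v_feval_le => // n.
apply: (@le_trans _ _ (wt g2 rho n)).
  by apply: wt_le => //; exact: absval_ge0.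
rewrite /wt /g2; case: leqP => h; first by rewrite v0 mul0r divr_ge0 ?absval_ge0.
by apply/ltW/hN; rewrite /M in h; lia.
Qed.

Lemma feval_le_small g e : F g -> 0 < e ->
  exists2 d, 0 < d & forall x, v x <= d -> v (feval g x) <= e.
Proof.
move=> gF e0; have [d d0 hd] := gaussnorm_small gF e0.
exists d => // x xd; have [->|x0] := eqVneq x 0.
  by rewrite feval0 // v0 ltW.
apply: v_feval_le => // n.
have vx : 0 < v x by rewrite v_gt0.
by apply: le_trans (hd _ vx xd); apply: wt_le_gaussnorm.
Qed.

(** Successive approximation: since [g] is additive, correcting by an approximate solution for the
    current error leaves an error at most half as large, and no correction leaves the disc of radius
    [rho]. *)
Lemma feval_surj_le g w i rho : F g -> g i != 0 -> 0 <= rho -> v w <= wt g rho i ->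
  exists2 z, feval g z = w & v z <= rho.
Proof.
move=> gF gi r0 wr; have gi0 : 0 < v (g i) by rewrite v_gt0.
(* The radius at which the term of index [i] weighs exactly [v w]. *)
pose bnd (w : C) := pw (v w / v (g i)) (- i).
have bndP w' z : v z <= bnd w' -> wt g (v z) i <= v w'.
  move=> h; have d0 : 0 <= v w' / v (g i) by rewrite divr_ge0 ?absval_ge0.
  rewrite /wt mulrC -ler_pdivlMr // -[leRHS](pwVK q1 i) //.
  by apply: (pw_le q1) => //; exact: absval_ge0.
have step w' : exists z, v z <= bnd w' /\ v (feval g z - w') <= v w' / 2.
  have [->|w0] := eqVneq w' 0.
    exists 0; rewrite v0 pw_ge0 feval0 // subr0 v0 mul0r; split => //.
  have d0 : 0 < v w' / v (g i) by rewrite divr_gt0 ?v_gt0.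
  have [||z zr hz] := @feval_approx_sol g w' i (bnd w') gF gi w0.
  - exact: pw_gt0.
  - exact: wt_at_radius (absval_ge0 v w') gi.
  by exists z.
have [Z hZ] := choice step.
(* [W n] is the error left after n corrections, and the solution is the sum of the [Z (W n)]. *)
pose W := fix W n := if n is m.+1 then W m - feval g (Z (W m)) else w.
have WS n : W n.+1 = W n - feval g (Z (W n)) by [].
have Wle n : v (W n) <= v w / 2 ^+ n.
  elim: n => [|n IHn]; first by rewrite expr0 divr1.
  rewrite WS -vN opprB; apply: le_trans (hZ _).2 _.
  by rewrite exprSr invfM mulrA ler_pM2r ?invr_gt0.
have W0 e : 0 < e -> exists N, forall n, (N <= n)%N -> v (W n) < e.
  move=> e0; exists (Num.bound (v w / e)) => n Nn; apply: le_lt_trans (Wle n) _.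
  have h := archi_boundP (divr_ge0 (absval_ge0 v w) (ltW e0)).
  rewrite ltr_pdivrMr ?exprn_gt0 // mulrC -ltr_pdivrMr //; apply: lt_trans h _.
  by rewrite -natrX ltr_nat; apply: leq_ltn_trans Nn _; exact: ltn_expl.
have Zle n : v (Z (W n)) <= pw (v (W n) / v (g i)) (- i) by exact: (hZ _).1.
have [z zl] : exists l, v_cvg_to v (series (fun n => Z (W n))) l.
  apply: v_series_cvg => //; apply/v_nullP => e e0.
  have pe : 0 < pw e i * v (g i) by rewrite mulr_gt0 // pw_gt0.
  have [N hN] := W0 _ pe; exists N => n /hN h; apply: le_lt_trans (Zle n) _.
  rewrite -[ltRHS](pwK q1 i) ?(ltW e0) //; apply: (pw_lt q1).
    by rewrite divr_ge0 ?absval_ge0.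
  by rewrite ltr_pdivrMr.
have gS n : feval g (series (fun n => Z (W n)) n) = w - W n.
  elim: n => [|n IHn]; first by rewrite /series /= big_geq // feval0 // subrr.
  by rewrite seriesSr /= fevalD // IHn; ring.
exists z.
  apply/eqP; rewrite -subr_eq0; apply/eqP; apply: (@v_eps_eq0 _ _ v) => e e0.
  have [d d0 hd] := feval_le_small gF e0.
  move/v_nullP: zl => /(_ d d0)[N1 hN1]; have [N2 hN2] := W0 e e0.
  pose n := (N1 + N2)%N.
  have -> : feval g z - w = - (feval g (series (fun n => Z (W n)) n - z) + W n).
    by rewrite fevalB // gS; ring.
  rewrite vN; apply: v_le_add; first by apply/hd/ltW/hN1; rewrite leq_addr.
  by apply/ltW/hN2; rewrite leq_addl.
apply: (v_cvg_to_le zl) => n; apply: v_sum_le => // j _.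
apply: le_trans (Zle j) _; rewrite -(pwK q1 i r0); apply: (pw_le q1).
  by rewrite divr_ge0 ?absval_ge0.
rewrite ler_pdivrMr // mulrC; apply: le_trans wr.
apply: le_trans (Wle j) _; rewrite ler_piMr ?absval_ge0 //.
by rewrite invf_le1 ?exprn_gt0 // exprn_ege1 // ler1n.
Qed.

Lemma feval_surj g w i : F g -> g i != 0 -> exists z, feval g z = w.
Proof.
move=> gF gi; have [||z zw _] := @feval_surj_le g w i (pw (v w / v (g i)) (- i)) gF gi.
- exact: pw_ge0.
- by rewrite wt_at_radius ?absval_ge0.
by exists z.
Qed.

(** The terms of maximal weight form a polynomial part with a zero x of absolute value r. As g(x)
    involves only smaller terms, some y with |y| < r satisfies g(y) = g(x), and x - y is the zero
    sought. *)
Lemma ex_zero_of_break g r i j : F g -> 0 < r -> g i != 0 -> i != j ->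
  dominant g r i -> dominant g r j -> exists2 z, feval g z = 0 & v z = r.
Proof.
move=> gF r0 gi ij di dj.
have G0 : 0 < gaussnorm g r by exact: (gaussnorm_gt0 gF r0 gi).
have [i0 d0 h0] := ex_first_dominant gF r0 gi.
have [i1 d1 h1] := ex_last_dominant gF r0 gi.
have lt01 : i0 < i1.
  have le0 l : dominant g r l -> i0 <= l.
    move=> /(dominantP _ gF r0) E; rewrite leNgt; apply/negP => /h0.
    by rewrite E ltxx.
  have le1 l : dominant g r l -> l <= i1.
    move=> /(dominantP _ gF r0) E; rewrite leNgt; apply/negP => /h1.
    by rewrite E ltxx.
  move: (le0 _ di) (le0 _ dj) (le1 _ di) (le1 _ dj) ij.
  by clear; lia.
pose D n := wt g r n == gaussnorm g r.
pose g1 n := if D n then g n else 0; pose g2 n := if D n then 0 else g n.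
have gE : g = fun n => g1 n + g2 n.
  by apply/funext => n; rewrite /g1 /g2; case: ifP; rewrite ?addr0 ?add0r.
have g1F : F g1.
  by apply: (calF_le gF) => n; rewrite /g1; case: ifP; rewrite ?v0 ?absval_ge0.
have g2F : F g2.
  by apply: (calF_le gF) => n; rewrite /g2; case: ifP; rewrite ?v0 ?absval_ge0.
have D0 : D i0 by apply/eqP/dominantP.
have D1 : D i1 by apply/eqP/dominantP.
pose K := (absz (i1 - i0)%R).+1; pose j1 := absz (i1 - i0)%R.
have g10 n : n < i0 \/ i0 + K%:Z <= n -> g1 n = 0.
  move=> h; rewrite /g1 ifF //; apply: lt_eqF.
  by case: h => h; [exact: h0|apply: h1; rewrite /K in h; lia].
have g1i0 : g1 i0 = g i0 by rewrite /g1 D0.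
have g1i1 : g1 i1 = g i1 by rewrite /g1 D1.
pose c l := qpow (g1 (i0 + l%:Z)) (- i0).
(* Dividing by X removes the zero at the origin; the constant coefficient then comes from the first
   dominant term, so a root is nonzero. *)
pose e l := (q ^ l).-1.
have qj0 (l : nat) : (0 < q ^ l)%N by rewrite expn_gt0; lia.
have einj : injective e.
  move=> a b ab; apply: (@expnI q) => //=.
  by rewrite -(prednK (qj0 a)) -(prednK (qj0 b)); congr _.+1.
pose P := \sum_(l < K) c l *: 'X^(e l).
have PX z : P.[z] * z = qpow (feval g1 z) (- i0).
  rewrite (feval_finite_poly z g10) !horner_sum mulr_suml; apply: eq_bigr => l _.
  by rewrite !hornerZ !hornerXn -mulrA -exprSr prednK.
have gi0n : g i0 != 0 by exact: (dominant_neq0 r0 gi d0).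
have gi1n : g i1 != 0 by exact: (dominant_neq0 r0 gi d1).
have P0 : P`_0 = qpow (g i0) (- i0).
  have := @coef_sum_monomials _ K c e 0 einj isT.
  by rewrite /e expn0 /= /c addr0 g1i0.
have j1E : i0 + j1%:Z = i1 by rewrite /j1; lia.
have Pj : P`_(e j1) = qpow (g i1) (- i0).
  have := @coef_sum_monomials _ K c e j1 einj (ltnSn _).
  by rewrite /c j1E g1i1.
have e1 : (0 < e j1)%N.
  have : (q ^ 0 < q ^ j1)%N by rewrite ltn_exp2l // /j1; lia.
  by rewrite /e expn0; lia.
have [||x Px xr] := @ex_root_le _ _ v r P (e j1) r0 e1.
- by rewrite Pj qpow_eq0.
- rewrite P0 Pj !v_qpow -(ler_pM2r r0) -mulrA -exprSr prednK //.
  have := (gaussnorm_dominant d0); rewrite (gaussnorm_dominant d1).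
  move=> /(congr1 (fun x => pw x (- i0))).
  rewrite (pw_wt g r i1) (pw_wt g r i0) subrr (pwr0 _ (ltW r0)) => <-.
  have -> : i1 - i0 = j1%:Z by rewrite -j1E addrAC subrr add0r.
  have := @pw_natX _ _ q1 r j1%:Z 0 j1 (ltW r0); rewrite addr0 expn0 expr1.
  by move=> /(_ erefl) ->.
have x0 : x != 0.
  apply: contraTneq Px => ->; rewrite /root horner_coef0 P0.
  by rewrite qpow_eq0.
have vx0 : 0 < v x by rewrite v_gt0.
have g1x : feval g1 x = 0.
  apply/eqP; rewrite -(qpow_eq0 _ (- i0)) -PX.
  by move/rootP: Px => ->; rewrite mul0r.
(* At a radius below r the first dominant term of [g1] would be strictly the largest, so [g1] could
   not vanish at x. *)
have vx : v x = r.
  apply/eqP; rewrite eq_le xr leNgt; apply/negP => xlt.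
  have : v (feval g1 x) = v (g1 i0 * qpow x i0).
    apply: (sumZ_dominant vc) => [|n ni]; first exact: eval_vnull.
    rewrite !wt_eval.
    have g1i0r : 0 < wt g1 (v x) i0 by apply: wt_gt0 => //; rewrite g1i0.
    have [->|g1n] := eqVneq (wt g1 (v x) n) 0; first exact: g1i0r.
    have Dn : D n by apply: contraNT g1n => nD; rewrite /wt /g1 (negbTE nD) v0 mul0r.
    have i0n : i0 < n.
      rewrite lt_def ni leNgt; apply/negP => /h0.
      by move/eqP: Dn => ->; rewrite ltxx.
    have xE : v x = r * (v x / r) by rewrite mulrC divfK ?gt_eqF.
    have c0 : 0 < v x / r by rewrite divr_gt0.
    rewrite xE !wt_scale ?(ltW r0) ?(ltW c0) //.
    have -> : wt g1 r n = gaussnorm g r by rewrite -(eqP Dn) /wt /g1 Dn.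
    have -> : wt g1 r i0 = gaussnorm g r by rewrite -(eqP D0) /wt g1i0.
    by rewrite ltr_pM2l // (pw_santi q1) // ltr_pdivrMr // mul1r.
  rewrite g1x v0 g1i0 => /esym/eqP; rewrite v_eq0 mulf_eq0 (negbTE gi0n).
  by rewrite qpow_eq0 (negbTE x0).
have [m hm] : exists m, forall n, wt g2 r n <= wt g2 r m.
  exact: (ex_dominant g2F r0).
have g2lt : wt g2 r m < gaussnorm g r.
  rewrite /g2 /wt; case: ifPn => [_|]; first by rewrite v0 mul0r.
  by rewrite /D lt_neqAle => ->; exact: wt_le_gaussnorm.
have gx : v (feval g x) <= wt g2 r m.
  rewrite gE feval_addl // g1x add0r; apply: v_feval_le => // n.
  by rewrite vx.
(* The radius at which the term [i0] weighs as much as the largest discarded term at r; that weight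
   is below the Gauss norm, hence rho < r. *)
pose rho := pw (wt g2 r m / v (g i0)) (- i0).
have vg0 : 0 < v (g i0) by rewrite v_gt0.
have dd0 : 0 <= wt g2 r m / v (g i0) by rewrite divr_ge0 ?absval_ge0 ?wt_ge0.
have [||y gy yr] := @feval_surj_le g (feval g x) i0 rho gF gi0n.
- exact: pw_ge0.
- by apply: le_trans gx _; rewrite (wt_at_radius (wt_ge0 _ _ _) gi0n).
have yltr : v y < r.
  apply: le_lt_trans yr _; rewrite -(pwK q1 i0 (ltW r0)); apply: (pw_lt q1) => //.
  by rewrite ltr_pdivrMr // mulrC -[X in _ < X]/(wt g r i0) -(gaussnorm_dominant d0).
exists (x - y); first by rewrite fevalB // gy subrr.
apply/eqP; rewrite eq_le; apply/andP; split.
  by apply: v_le_add; rewrite ?vN ?vx // ltW.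
rewrite leNgt; apply/negP => h; have := @v_ultraB _ _ v (x - y) (- y) r h.
by rewrite vN => /(_ yltr); rewrite opprK subrK vx ltxx.
Qed.

(** * Division *)

(** Solving |g_i| c^(q^i) = |g_j| c^(q^j) for c gives the power 1 / (q^j - q^i) of |g_i| / |g_j|. *)
Lemma ex_crossing_radius g i j : i < j -> g i != 0 -> g j != 0 ->
  exists2 c, 0 < c & wt g c i = wt g c j.
Proof.
move=> ij gi gj; pose d := (q%:R : R) ^ j - q%:R ^ i.
have d0 : 0 < d by rewrite subr_gt0 ltr_eXz2l // ltr1n.
have vi : 0 < v (g i) by rewrite v_gt0.
have vj : 0 < v (g j) by rewrite v_gt0.
have x0 : 0 < v (g i) / v (g j) by rewrite divr_gt0.
pose c := (v (g i) / v (g j)) `^ d^-1; have c0 : 0 < c by rewrite powR_gt0.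
exists c => //.
have -> : wt g c j = v (g j) * (pw c i * c `^ d).
  rewrite /wt /pw -powRD; last by rewrite (gt_eqF c0) implybT.
  by rewrite /d addrC subrK.
rewrite /c -powRrM mulVf ?gt_eqF // powRr1 ?(ltW x0) // /wt.
by field; rewrite gt_eqF.
Qed.

(* The radius where the terms [i] and [j] have equal weights is a break unless some
   index strictly between [i] and [j] dominates there; then recurse. *)
Lemma ex_break g s r i j n : F g -> g n != 0 -> 0 < s -> s <= r -> i < j ->
  dominant g s i -> dominant g r j ->
  exists c a b, [/\ s <= c, c <= r, a != b, dominant g c a & dominant g c b].
Proof.
move=> gF gn s0.
have [N] := ubnP (absz (j - i)%R); elim: N r j => // N IHN r j jiN sr ij di dj.
have r0 := lt_le_trans s0 sr.
have gi := dominant_neq0 s0 gn di; have gj := dominant_neq0 r0 gn dj.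
have [c c0 cE] := ex_crossing_radius ij gi gj.
(* Above the crossing radius the term j exceeds the term i, contradicting dominance of i at s; the
   bound by r is symmetric. *)
have sc : s <= c.
  rewrite leNgt; apply/negP => cs; have := di j; rewrite leNgt => /negP; apply.
  have k1 : 1 < s / c by rewrite ltr_pdivlMr // mul1r.
  have -> : s = c * (s / c) by rewrite mulrC divfK ?gt_eqF.
  rewrite !wt_scale ?(ltW c0) ?divr_ge0 ?(ltW s0) ?(ltW c0) // cE.
  by rewrite ltr_pM2l ?wt_gt0 // (pw_smono q1).
have cr : c <= r.
  rewrite leNgt; apply/negP => rc.
  have k1 : 1 < c / r by rewrite ltr_pdivlMr // mul1r.
  have E : c = r * (c / r) by rewrite mulrC divfK ?gt_eqF.
  move: cE; rewrite E !wt_scale ?(ltW r0) ?divr_ge0 ?(ltW r0) ?(ltW c0) //.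
  apply/eqP; rewrite lt_eqF //; apply: (@le_lt_trans _ _ (wt g r j * pw (c / r) i)).
    by rewrite ler_wpM2r ?pw_ge0.
  by rewrite ltr_pM2l ?wt_gt0 // (pw_smono q1).
have [dci|ndci] := pselect (dominant g c i).
  exists c, i, j; split=> //; first by rewrite lt_eqF.
  by move=> m; rewrite -cE.
have [l dl] := ex_dominant gF c0.
have li : l != i by apply/eqP => E; apply: ndci; rewrite -E.
have lj : l != j.
  by apply/eqP => E; apply: ndci => m; rewrite cE -E.
have il : i <= l.
  have [sc'|cs'] := ltP s c; first exact: (dominant_mono gn s0 sc' di dl).
  by case: ndci; have -> : c = s by apply/eqP; rewrite eq_le cs' sc.
have lj' : l <= j.
  have [cr'|rc'] := ltP c r; first exact: (dominant_mono gn c0 cr' dl dj).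
  by case: ndci => m; rewrite cE; have -> : c = r by apply/eqP; rewrite eq_le rc' cr.
have [||c' [a [b [sc' c'c ab da db]]]] := IHN c l _ sc _ di dl.
- by clear - jiN li lj il lj'; lia.
- by rewrite lt_def li.
by exists c', a, b; split => //; exact: le_trans cr.
Qed.

Lemma fcomp_addr h g g' n : F h -> F g -> F g' ->
  fcomp h (fun i => g i + g' i) n = fcomp h g n + fcomp h g' n.
Proof.
move=> hF gF g'F; rewrite /fcomp -sumZD //; [|exact: comp_vnull..].
by congr sumZ; apply/funext => i; rewrite qpowD mulrDr.
Qed.

(** * Splitting off a zero by a right factor 1 + c tau *)

Definition binomial_series (c : C) : int -> C :=
  fun n => if n == 0 then 1 else if n == 1 then c else 0.

Lemma calF_binomial c : F (binomial_series c).
Proof.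
apply: (@calF_finsupp _ [:: 0; 1]) => n.
by rewrite !inE negb_or /binomial_series => /andP[/negbTE -> /negbTE ->].
Qed.

Lemma fcomp_binomial f c n :
  fcomp f (binomial_series c) n = f n + f (n - 1) * qpow c (n - 1).
Proof.
rewrite /fcomp (@sumZ_finite _ _ _ vc [:: n; n - 1]) //=.
- rewrite big_cons big_seq1 subrr /binomial_series /= qpow1r mulr1.
  by have -> : n - (n - 1) = 1 by lia.
- by rewrite inE andbT; lia.
move=> i; rewrite !inE negb_or => /andP[ni ni1].
rewrite /binomial_series; have -> : (n - i == 0) = false by lia.
have -> : (n - i == 1) = false by lia.
by rewrite qpow0r mulr0.
Qed.

(** With a right factor of two terms, associativity is the addition of two sums, without interchange
    of summations. *)
Lemma fcomp_binomialA h g c : F h -> F g ->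
  fcomp h (fcomp g (binomial_series c)) = fcomp (fcomp h g) (binomial_series c).
Proof.
move=> hF gF; apply/funext => n; rewrite fcomp_binomial.
have n1 := comp_vnull n hF gF.
have n2 := comp_vnull (n - 1) hF gF.
have n3 : vnull v (fun i => qpow c (n - 1) * (h i * qpow (g (n - 1 - i)) i)).
  by apply: (vnull_map _ n2); exact: mull_continuous.
transitivity (sumZ v (fun i => h i * qpow (g (n - i)) i +
    qpow c (n - 1) * (h i * qpow (g (n - 1 - i)) i))); last first.
  by rewrite sumZD // -sumZ_mull // [_ * qpow c _]mulrC.
congr sumZ; apply/funext => i; rewrite fcomp_binomial qpowD.
rewrite qpowM qpow_qpow mulrDr.
have -> : n - i - 1 + i = n - 1 by lia.
have -> : n - i - 1 = n - 1 - i by lia.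
by congr (_ + _); rewrite mulrA mulrC.
Qed.

(* 1 - l^(1-q) tau, which vanishes at [l]. *)
Definition zero_factor (l : C) : int -> C := binomial_series (- (l / qpow l 1)).

Lemma wt_zero_factor0 l rho : 0 <= rho -> wt (zero_factor l) rho 0 = rho.
Proof. by move=> r0; rewrite /wt /zero_factor /binomial_series /= v1 mul1r pwr0. Qed.

Lemma wt_zero_factor1 l rho : 0 <= rho ->
  wt (zero_factor l) rho 1 = v l * pw (rho / v l) 1.
Proof.
move=> r0; rewrite /wt /zero_factor /binomial_series vN absvalM vV.
rewrite v_qpow -(pwV q1) ?absval_ge0 // -mulrA.
by rewrite -pwM ?invr_ge0 ?absval_ge0 // (mulrC rho).
Qed.

Lemma wt_zero_factor_out l rho n : n < 0 \/ 1 < n -> wt (zero_factor l) rho n = 0.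
Proof.
move=> h; rewrite /wt /zero_factor /binomial_series.
have -> : (n == 0) = false by lia.
have -> : (n == 1) = false by lia.
by rewrite v0 mul0r.
Qed.

Lemma zero_factor_neq0 l : zero_factor l 0 != 0.
Proof. by rewrite /zero_factor /binomial_series eqxx oner_eq0. Qed.

Lemma dominant_zero_factor_small l rho : 0 < rho -> rho <= v l ->
  dominant (zero_factor l) rho 0.
Proof.
move=> r0 rl n; have l0 := lt_le_trans r0 rl.
have [n0|n0|->] := ltgtP n 0; last by [].
  by rewrite wt_zero_factor_out ?wt_ge0 //; left.
have [n1|n1|->] := ltgtP n 1; first by move: n0 n1; lia.
  by rewrite wt_zero_factor_out ?wt_ge0 //; right.
rewrite wt_zero_factor1 ?(ltW r0) // wt_zero_factor0 ?(ltW r0) //.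
apply: (@le_trans _ _ (v l * pw (rho / v l) 0)).
  rewrite ler_pM2l //; apply: (pw_anti q1) => //; first exact: divr_gt0.
  by rewrite ler_pdivrMr // mul1r.
by rewrite pwr0 ?divr_ge0 ?(ltW r0) ?(ltW l0) // mulrC divfK ?gt_eqF.
Qed.

Lemma dominant_zero_factor_large l rho : 0 < v l -> v l <= rho ->
  dominant (zero_factor l) rho 1.
Proof.
move=> l0 lr n; have r0 := lt_le_trans l0 lr.
have [n1|n1|->] := ltgtP n 1; last by [].
  have [n0|n0|->] := ltgtP n 0.
  - by rewrite wt_zero_factor_out ?wt_ge0 //; left.
  - by move: n0 n1; lia.
  rewrite wt_zero_factor1 ?(ltW r0) // wt_zero_factor0 ?(ltW r0) //.
  apply: (@le_trans _ _ (v l * pw (rho / v l) 0)).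
    by rewrite pwr0 ?divr_ge0 ?(ltW r0) ?(ltW l0) // mulrC divfK ?gt_eqF.
  rewrite ler_pM2l //; apply: (pw_mono q1) => //.
  by rewrite ler_pdivlMr // mul1r.
by rewrite wt_zero_factor_out ?wt_ge0 //; right.
Qed.

(* The coefficients of the quotient are l^(-q^n) P_n with
   P_n = \sum_(i <= n) f_i l^(q^i); as [feval f l = 0], this is also
   - \sum_(i > n) f_i l^(q^i), and each form is small at one end. *)
Lemma factor_zero f l : F f -> l != 0 -> feval f l = 0 ->
  exists2 f1, F f1 & f = fcomp f1 (zero_factor l).
Proof.
move=> fF l0 fl; have vl0 : 0 < v l by rewrite v_gt0.
have nf := eval_vnull l fF.
pose P (n : int) := sumZ v (fun i => if i <= n then f i * qpow l i else 0).
have nP n : vnull v (fun i => if i <= n then f i * qpow l i else 0).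
  exact: (vnull_off (fun i => i <= n)).
have PS n : P n = P (n - 1) + f n * qpow l n.
  rewrite /P -[X in _ + X](sumZ_delta vc n) -sumZD //; last exact: vnull_delta.
  congr sumZ; apply/funext => i; have [->|ni] := eqVneq i n.
    by rewrite lexx ifF ?add0r //; lia.
  by rewrite addr0; have -> : (i <= n - 1) = (i <= n) by lia.
have PN n : P n = - sumZ v (fun i => if n < i then f i * qpow l i else 0).
  have nP' : vnull v (fun i => if n < i then f i * qpow l i else 0).
    exact: (vnull_off (fun i => n < i)).
  apply/eqP; rewrite -subr_eq0 opprK -sumZD // -[X in _ == X]fl; apply/eqP.
  congr sumZ; apply/funext => i; rewrite ltNge.
  by case: (i <= n); rewrite ?addr0 ?add0r.
have lowP n B : 0 <= B -> (forall i, i <= n -> wt f (v l) i <= B) -> v (P n) <= B.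
  move=> B0 h; apply: sumZ_le => // i; case: ifP => [/h|_]; last by rewrite v0.
  by rewrite wt_eval.
have highP n B : 0 <= B -> (forall i, n < i -> wt f (v l) i <= B) -> v (P n) <= B.
  move=> B0 h; rewrite PN vN; apply: sumZ_le => // [|i].
    exact: (vnull_off (fun i => n < i)).
  by case: ifP => [/h|_]; [rewrite wt_eval|rewrite v0].
have ql0 n : qpow l n != 0 by rewrite qpow_eq0.
pose f1 n := P n / qpow l n.
have f1F : F f1.
  apply/calFP => rho0 rho00.
  pose rho := Num.max rho0 (v l); have rl : v l <= rho by rewrite le_max lexx orbT.
  have r0 := lt_le_trans vl0 rl.
  apply: (@rnull_le _ _ _ (wt f1 rho)) => [n|].
    by apply: wt_le; [exact: ltW|rewrite le_max lexx].
  have wtE n : wt f1 rho n = v (P n) * pw (rho / v l) n.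
    rewrite /wt /f1 absvalM vV v_qpow -mulrA; congr (_ * _).
    by rewrite pwM ?(ltW r0) ?invr_ge0 ?(ltW vl0) // (pwV q1) ?(ltW vl0) // mulrC.
  have k1 : 1 <= rho / v l by rewrite ler_pdivlMr // mul1r.
  have k0 : 0 < rho / v l by exact: divr_gt0.
  apply/rnull_intP => e e0.
  (* The second bound serves n < 0, where the power q^n of [rho / v l] is at most [rho / v l]
     itself. *)
  pose e1 := Num.min (e / 2) (e / 2 / (rho / v l)).
  have e10 : 0 < e1 by rewrite lt_min !divr_gt0.
  have /calFP/(_ _ r0)/rnull_intP/(_ _ (divr_gt0 e0 (ltr0Sn _ 1)))[N1 hN1] := fF.
  have /calFP/(_ _ vl0)/rnull_intP/(_ _ e10)[N2 hN2] := fF.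
  exists (N1 + N2)%N => n nN; rewrite wtE.
  apply: (@le_lt_trans _ _ (e / 2)); last by lra.
  have [n0|n0] := leP 0 n.
    rewrite -ler_pdivlMr ?pw_gt0 //; apply: highP => [|i ni].
      by rewrite divr_ge0 ?pw_ge0 // ltW // divr_gt0.
    rewrite ler_pdivlMr ?pw_gt0 //.
    apply: (@le_trans _ _ (wt f (v l) i * pw (rho / v l) i)).
      by rewrite ler_wpM2l ?wt_ge0 //; apply: (pw_mono q1) => //; exact: ltW.
    rewrite -wt_scale ?(ltW vl0) ?(ltW k0) // mulrC divfK ?gt_eqF //.
    by apply/ltW/hN1; clear - nN n0 ni; lia.
  apply: (@le_trans _ _ (v (P n) * pw (rho / v l) 0)).
    by rewrite ler_wpM2l ?absval_ge0 //; apply: (pw_mono q1) => //; exact: ltW.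
  rewrite (pwr0 _ (ltW k0)) -ler_pdivlMr //; apply: lowP => [|i ni].
    by rewrite ltW // !divr_gt0.
  apply: (@le_trans _ _ e1); last by rewrite ge_min lexx orbT.
  by apply/ltW/hN2; clear - nN n0 ni; lia.
exists f1 => //; apply/funext => n; rewrite fcomp_binomial qpowN.
rewrite qpowM qpowV qpow_qpow.
have -> : 1 + (n - 1) = n by lia.
rewrite /f1 PS mulrDl mulfK // mulrN mulrA divfK //.
by rewrite addrAC subrr add0r.
Qed.

(** * Approximate quotients on an annulus *)

(** Terms below m lose against m as the radius grows from s, and terms above m lose as it shrinks
    from r. *)
Lemma dominant_between g s r rho m : 0 < s -> s <= rho -> rho <= r ->
  dominant g s m -> dominant g r m -> dominant g rho m.
Proof.
move=> s0 sr rr ds dr n; have rho0 := lt_le_trans s0 sr; have r0 := lt_le_trans rho0 rr.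
have [nm|/ltW mn] := leP n m.
  have k0 : 0 < rho / s by exact: divr_gt0.
  have -> : rho = s * (rho / s) by rewrite mulrC divfK ?gt_eqF.
  rewrite !wt_scale ?(ltW s0) ?(ltW k0) //; apply: ler_pM; rewrite ?wt_ge0 ?pw_ge0 //.
  by apply: (pw_mono q1) => //; rewrite ler_pdivlMr // mul1r.
have k0 : 0 < rho / r by exact: divr_gt0.
have -> : rho = r * (rho / r) by rewrite mulrC divfK ?gt_eqF.
rewrite !wt_scale ?(ltW r0) ?(ltW k0) //; apply: ler_pM; rewrite ?wt_ge0 ?pw_ge0 //.
by apply: (pw_anti q1) => //; rewrite ler_pdivrMr // mul1r.
Qed.

(* With [S], [y], [Y] the Gauss norms of [g] at s <= rho <= r, if the same term of
   [g] is dominant throughout then all its other terms are bounded at [rho] by this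
   quantity, which is small compared to [y] when S << y << Y. *)
Definition remainder_radius (S Y y : R) : R := Num.max (y ^+ 2 / Y) (Num.sqrt (S * y)).

(** Both bounds see [g] only through its Gauss norms. By Gauss's lemma they are therefore preserved
    when [f] and [g] are composed on the right with the same zero factor, which merely
    reparametrizes the radii. *)
Definition approx_quotient (f g h : int -> C) (s r : R) : Prop :=
  forall rho, s <= rho -> rho <= r ->
    gaussnorm h (gaussnorm g rho) <= gaussnorm f rho /\
    gaussnorm (fun n => f n - fcomp h g n) rho <=
      gaussnorm h (remainder_radius (gaussnorm g s) (gaussnorm g r) (gaussnorm g rho)).

(** [h] is the exact quotient of [f] by the monomial of index m, so the remainder is - h o g2 with
    [g2] the other terms of [g]. *)
Lemma approx_quotient_monomial f g s r m : F f -> F g -> g m != 0 ->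
  0 < s -> s <= r -> dominant g s m -> dominant g r m ->
  exists2 h, F h & approx_quotient f g h s r.
Proof.
move=> fF gF gm s0 sr ds dr; have r0 := lt_le_trans s0 sr.
pose h n := f (n + m) / qpow (g m) n.
have vgm : 0 < v (g m) by rewrite v_gt0.
have qg n : qpow (g m) n != 0 by rewrite qpow_eq0.
have hE rho n : wt h (wt g rho m) n = wt f rho (n + m).
  rewrite {1}/wt pw_wt /h absvalM vV v_qpow.
  by rewrite mulrA divfK ?(addrC m) // gt_eqF // pw_gt0.
have hF : F h.
  apply/calFP => rho' r'0.
  pose rho := pw (rho' / v (g m)) (- m).
  have rho0 : 0 < rho by rewrite pw_gt0 // divr_gt0.
  have rE : wt g rho m = rho' by exact: (wt_at_radius (ltW r'0) gm).
  move=> e e0; have /calFP/(_ _ rho0 _ e0)[u hu] := fF.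
  exists (map (fun i => i - m) u) => n nu; rewrite -rE hE; apply: hu.
  by apply: contra nu => nu; apply/mapP; exists (n + m) => //; rewrite addrK.
exists h => // rho srho rhor; have rho0 := lt_le_trans s0 srho.
have drho := dominant_between s0 srho rhor ds dr.
have y0 : 0 < gaussnorm g rho by exact: (gaussnorm_gt0 gF rho0 gm).
split.
  apply: gaussnorm_le => // n; rewrite (gaussnorm_dominant drho) hE.
  exact: wt_le_gaussnorm.
pose g1 n := if n == m then g m else 0; pose g2 n := if n == m then 0 else g n.
have gE : g = fun n => g1 n + g2 n.
  by apply/funext => n; rewrite /g1 /g2; case: eqP => [->|_]; rewrite ?addr0 ?add0r.
have g1F : F g1.
  apply: (calF_le gF) => n.
  by rewrite /g1; case: eqP => [->|_]; rewrite ?v0 ?absval_ge0.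
have g2F : F g2.
  apply: (calF_le gF) => n.
  by rewrite /g2; case: eqP => [->|_]; rewrite ?v0 ?absval_ge0.
have hg1 n : fcomp h g1 n = f n.
  rewrite /fcomp (@sumZ_finite _ _ _ vc [:: n - m]) //.
    rewrite big_seq1 /g1; have -> : n - (n - m) = m by rewrite subKr.
    by rewrite eqxx /h subrK divfK.
  move=> i; rewrite inE /g1 => ni; have -> : (n - i == m) = false by clear - ni; lia.
  by rewrite qpow0r mulr0.
have -> : (fun n => f n - fcomp h g n) = fun n => - fcomp h g2 n.
  by apply/funext => n; rewrite gE fcomp_addr // hg1 opprD addrA subrr add0r.
have h2F := calF_fcomp hF g2F.
have S0 : 0 < gaussnorm g s by exact: (gaussnorm_gt0 gF s0 gm).
have Y0 : 0 < gaussnorm g r by exact: (gaussnorm_gt0 gF r0 gm).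
apply: gaussnorm_le => // [|n]; first exact: calFN.
rewrite wtN; apply: fcomp_wt_le => // [|j].
  by rewrite lt_max divr_gt0 // exprn_gt0.
have [jm|mj|->] := ltgtP j m.
(* With c the power q^m of rho / s, one has y = S c; a term below m weighs at most S sqrt(c) =
   sqrt(S y). *)
- rewrite le_max; apply/orP; right.
  have k0 : 0 < rho / s by exact: divr_gt0.
  have k1 : 1 <= rho / s by rewrite ler_pdivlMr // mul1r.
  have rE : rho = s * (rho / s) by rewrite mulrC divfK ?gt_eqF.
  have c1 : 1 <= pw (rho / s) m by rewrite -(pw1r R q m) (pw_le q1).
  have yE : gaussnorm g rho = gaussnorm g s * pw (rho / s) m.
    rewrite (gaussnorm_dominant drho) (gaussnorm_dominant ds) {1}rE.
    by rewrite wt_scale ?(ltW s0) ?(ltW k0).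
  have -> : Num.sqrt (gaussnorm g s * gaussnorm g rho) =
      gaussnorm g s * Num.sqrt (pw (rho / s) m).
    by rewrite yE mulrA -expr2 sqrtrM ?sqr_ge0 // sqrtr_sqr ger0_norm // ltW.
  have -> : wt g2 rho j = wt g s j * pw (rho / s) j.
    rewrite -wt_scale ?(ltW s0) ?(ltW k0) // -rE /wt /g2.
    by rewrite ?(lt_eqF jm) ?(gt_eqF mj).
  apply: ler_pM; rewrite ?wt_ge0 ?pw_ge0 //; first exact: wt_le_gaussnorm.
  have -> : j = m + (j - m) by rewrite addrC subrK.
  by rewrite -(pw_pw q1); apply: (pw_le_sqrt q1) => //; rewrite subr_lt0.
(* With c the power q^m of rho / r, one has y = Y c; a term above m weighs at most Y c^2 = y^2 /
   Y. *)
- rewrite le_max; apply/orP; left.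
  have k0 : 0 < rho / r by exact: divr_gt0.
  have k1 : rho / r <= 1 by rewrite ler_pdivrMr // mul1r.
  have rE : rho = r * (rho / r) by rewrite mulrC divfK ?gt_eqF.
  have c1 : pw (rho / r) m <= 1 by rewrite -(pw1r R q m) (pw_le q1) // ltW.
  have yE : gaussnorm g rho = gaussnorm g r * pw (rho / r) m.
    rewrite (gaussnorm_dominant drho) (gaussnorm_dominant dr) {1}rE.
    by rewrite wt_scale ?(ltW r0) ?(ltW k0).
  have -> : gaussnorm g rho ^+ 2 / gaussnorm g r =
      gaussnorm g r * pw (rho / r) m ^+ 2.
    by rewrite yE; field; rewrite gt_eqF.
  have -> : wt g2 rho j = wt g r j * pw (rho / r) j.
    rewrite -wt_scale ?(ltW r0) ?(ltW k0) // -rE /wt /g2.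
    by rewrite ?(lt_eqF jm) ?(gt_eqF mj).
  apply: ler_pM; rewrite ?wt_ge0 ?pw_ge0 //; first exact: wt_le_gaussnorm.
  have -> : j = m + (j - m) by rewrite addrC subrK.
  by rewrite -(pw_pw q1); apply: (pw_le_sqr q1); rewrite ?pw_ge0 ?subr_gt0.
by rewrite /wt /g2 eqxx v0 mul0r le_max divr_ge0 ?(ltW Y0) // sqr_ge0.
Qed.

(* Induction on the difference between the last dominant index at [r] and the
   first one at [s], which drops by one when a zero is split off. *)
Lemma ex_approx_quotient f g s r n : F f -> F g -> g n != 0 -> 0 < s -> s < r ->
  (forall z, feval g z = 0 -> feval f z = 0) ->
  exists2 h, F h & approx_quotient f g h s r.
Proof.
move=> fF gF gn s0 sr kfg.
have [N hN] : exists N : nat, forall i j, dominant g s i -> dominant g r j ->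
    j - i <= N%:Z.
  have r0 := lt_trans s0 sr.
  have [i di hi] := ex_first_dominant gF s0 gn.
  have [j dj hj] := ex_last_dominant gF r0 gn.
  exists (absz (j - i)%R) => i' j' /(dominantP _ gF s0) di'.
  move=> /(dominantP _ gF r0) dj'.
  have ii : i <= i' by rewrite leNgt; apply/negP => /hi; rewrite di' ltxx.
  have jj : j' <= j by rewrite leNgt; apply/negP => /hj; rewrite dj' ltxx.
  by lia.
elim: N f g s r n fF gF gn s0 sr kfg hN => [|N IHN] f g s r n fF gF gn s0 sr kfg hN;
  have r0 := lt_trans s0 sr;
  have [i di] := ex_dominant gF s0;
  have [j dj] := ex_dominant gF r0;
  have ij := dominant_mono gn s0 sr di dj.
  have ji := hN _ _ di dj; have E : j = i by lia.
  rewrite E in dj; apply: (@approx_quotient_monomial _ _ _ _ i) => //.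
    exact: (dominant_neq0 s0 gn di).
  exact: ltW.
have [E|ij'] := eqVneq i j.
  rewrite -E in dj; apply: (@approx_quotient_monomial _ _ _ _ i) => //.
    exact: (dominant_neq0 s0 gn di).
  exact: ltW.
have {ij ij'} ij : i < j by rewrite lt_neqAle ij'.
have [c [a [b [sc cr ab da db]]]] := ex_break gF gn s0 (ltW sr) ij di dj.
have c0 := lt_le_trans s0 sc.
have [l gl vl] := ex_zero_of_break gF c0 (dominant_neq0 c0 gn da) ab da db.
have l0 : l != 0 by rewrite -(v_gt0 v) vl.
have [g1 g1F g1E] := factor_zero gF l0 gl.
have [f1 f1F f1E] := factor_zero fF l0 (kfg _ gl).
set e := zero_factor l in g1E f1E.
have eF : F e by exact: calF_binomial.
have e0 : e 0 != 0 by exact: zero_factor_neq0.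
have [m g1m] : exists m, g1 m != 0.
  apply: contrapT => h; have g10 m : g1 m = 0.
    by apply/eqP; apply/negP => /negP ?; apply: h; exists m.
  by move/eqP: gn; apply; rewrite g1E fcomp_binomial !g10 mul0r addr0.
have gnE f' rho : F f' -> 0 < rho ->
    gaussnorm (fcomp f' e) rho = gaussnorm f' (gaussnorm e rho).
  by move=> f'F rho0; exact: (gaussnorm_fcomp f'F eF rho0 e0).
have es0 : 0 < gaussnorm e s by exact: (gaussnorm_gt0 eF s0 e0).
have er0 : 0 < gaussnorm e r by exact: (gaussnorm_gt0 eF r0 e0).
have [|||h hF hq] := IHN f1 g1 (gaussnorm e s) (gaussnorm e r) m f1F g1F g1m es0.
- exact: (gaussnorm_smono eF e0 s0 sr).
(* The inclusion of kernels passes to [g1] and [f1] because every [w] is a value e(z) of the zero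
   factor. *)
- move=> w g1w; have [z ez] := feval_surj w eF e0.
  have := kfg z; rewrite f1E g1E !feval_fcomp // ez; exact.
- move=> i1 j1 di1 dj1.
  have [i2 di2 hi2] := ex_first_dominant g1F es0 g1m.
  have [j2 dj2 hj2] := ex_last_dominant g1F er0 g1m.
  have ii : i2 <= i1.
    rewrite leNgt; apply/negP => /hi2.
    by move/(dominantP _ g1F es0): di1 => ->; rewrite ltxx.
  have jj : j1 <= j2.
    rewrite leNgt; apply/negP => /hj2.
    by move/(dominantP _ g1F er0): dj1 => ->; rewrite ltxx.
  (* The zero factor has dominant index 0 at s <= |l| and 1 at r >= |l|, so composing with it widens
     the range of dominant indices by one. *)
  have dI : dominant g s (i2 + 0).
    rewrite g1E; apply: (dominant_fcomp_first g1F eF s0 g1m e0 di2) => //.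
      by apply: dominant_zero_factor_small => //; rewrite vl.
    by move=> t t0; rewrite wt_zero_factor_out //; left.
  have dJ : dominant g r (j2 + 1).
    rewrite g1E; apply: (dominant_fcomp_last g1F eF r0 g1m e0 dj2) => //.
      by apply: dominant_zero_factor_large => //; rewrite vl.
    by move=> t t0; rewrite wt_zero_factor_out //; right.
  by move: (hN _ _ dI dJ) ii jj; clear; lia.
exists h => // rho srho rhor; have rho0 := lt_le_trans s0 srho.
have [||h1 h2] := hq (gaussnorm e rho).
- exact: gaussnorm_mono.
- exact: gaussnorm_mono.
have hg1F := calF_fcomp hF g1F.
have -> : (fun n => f n - fcomp h g n) = fcomp (fun n => f1 n - fcomp h g1 n) e.
  apply/funext => t; rewrite fcomp_subl // -f1E; congr (_ - _).
  by rewrite g1E fcomp_binomialA.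
have dF := calFB f1F hg1F.
rewrite f1E g1E (gnE _ _ dF rho0) (gnE _ _ f1F rho0) (gnE _ _ g1F s0).
by rewrite (gnE _ _ g1F r0) (gnE _ _ g1F rho0); split.
Qed.

(** With sigma ([sg]) such that |f|_sigma <= e, it suffices that the remainder radius be at most t =
    |g|_sigma: the first clause of [approx_quotient] at sigma then bounds the second clause at
    rho. *)
Lemma approx_quotient_remainder f g n rho e : F f -> F g -> g n != 0 ->
  0 < rho -> 0 < e -> exists d A, 0 < d /\ forall s r h, F h -> 0 < s -> s <= d ->
    A <= r -> approx_quotient f g h s r ->
    gaussnorm (fun n => f n - fcomp h g n) rho <= e.
Proof.
move=> fF gF gn r0 e0.
have [sg sg0 hsg] := gaussnorm_small fF e0.
have y0 : 0 < gaussnorm g rho by exact: (gaussnorm_gt0 gF r0 gn).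
have t0 : 0 < gaussnorm g sg by exact: (gaussnorm_gt0 gF sg0 gn).
set y := gaussnorm g rho in y0 *; set t := gaussnorm g sg in t0 *.
(* For s <= d this gives S y <= t^2, which handles the square root. *)
have [d d0 hd] := gaussnorm_small gF (divr_gt0 (exprn_gt0 2 t0) y0).
(* At radius [A] the term of index n alone weighs y^2 / t, so Y >= y^2 / t for r >= A. *)
pose A := pw (y ^+ 2 / t / v (g n)) (- n).
have yt0 : 0 < y ^+ 2 / t by rewrite divr_gt0 // exprn_gt0.
have A0 : 0 < A by rewrite pw_gt0 // divr_gt0 // v_gt0.
exists (Num.min d (Num.min sg rho)), (Num.max A (Num.max sg rho)).
split=> [|s r h hF s0]; first by rewrite !lt_min d0 sg0.
rewrite !le_min !ge_max => /and3P[sd ssg srho] /and3P[Ar sgr rhor] hq.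
have rr0 := lt_le_trans A0 Ar.
have [_ h2] := hq rho srho rhor; have [h1 _] := hq sg ssg sgr.
have S0 : 0 < gaussnorm g s by exact: (gaussnorm_gt0 gF s0 gn).
have Y0 : 0 < gaussnorm g r by exact: (gaussnorm_gt0 gF rr0 gn).
apply: le_trans h2 _; apply: le_trans (hsg sg sg0 (lexx _)); apply: le_trans h1.
apply: gaussnorm_mono => //.
  by rewrite lt_max divr_gt0 // exprn_gt0.
rewrite /remainder_radius ge_max -/y -/t; apply/andP; split.
  rewrite ler_pdivrMr // mulrC -ler_pdivrMr //.
  apply: le_trans (wt_le_gaussnorm n gF rr0).
  rewrite -[leLHS](wt_at_radius (ltW yt0) gn).
  by apply: wt_le => //; exact: ltW.
rewrite -[leRHS]ger0_norm ?(ltW t0) // -sqrtr_sqr ler_sqrt ?sqr_ge0 //.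
by rewrite -ler_pdivlMr //; exact: hd.
Qed.

(** * Passage to the limit and uniqueness *)

(** Estimates on the quotients are available only at radii of the form |g|_rho; this carries them
    over to all radii. *)
Lemma gaussnorm_unbounded g n B : F g -> g n != 0 -> 0 < B ->
  exists2 rho, 0 < rho & B <= gaussnorm g rho.
Proof.
move=> gF gn B0; exists (pw (B / v (g n)) (- n)).
  by rewrite pw_gt0 // divr_gt0 // v_gt0.
rewrite -[leLHS](wt_at_radius (ltW B0) gn).
by apply: wt_le_gaussnorm => //; rewrite pw_gt0 // divr_gt0 // v_gt0.
Qed.

Lemma ex_quotient f g n : F f -> F g -> g n != 0 ->
  (forall z, feval g z = 0 -> feval f z = 0) ->
  exists2 h, F h & f = fcomp h g.
Proof.
move=> fF gF gn kfg.
(* These annuli exhaust all radii; starting at 2 makes s < 1 < r. *)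
pose s (N : nat) : R := N.+2%:R^-1; pose r (N : nat) : R := N.+2%:R.
have s0 N : 0 < s N by rewrite invr_gt0 ltr0n.
have sr N : s N < r N.
  apply: (@lt_trans _ _ 1); last by rewrite ltr1n.
  by rewrite invf_lt1 ?ltr1n ?ltr0n.
have /choice[h hP] : forall N, exists h, F h /\ approx_quotient f g h (s N) (r N).
  by move=> N; have [h] := ex_approx_quotient fF gF gn (s0 N) (sr N) kfg; exists h.
have hF N : F (h N) by have [] := hP N.
have hgF N : F (fcomp (h N) g) by exact: calF_fcomp.
have small rho e : 0 < rho -> 0 < e -> exists N0, forall N, (N0 <= N)%N ->
    gaussnorm (fun n => f n - fcomp (h N) g n) rho <= e.
  move=> r0 e0; have [d [A [d0 hdA]]] := approx_quotient_remainder fF gF gn r0 e0.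
  exists (Num.bound (d^-1) + Num.bound `|A|)%N => N NN.
  have [hNF hNq] := hP N; apply: hdA hNF (s0 N) _ _ hNq.
    rewrite -[d]invrK lef_pV2 ?posrE ?invr_gt0 ?ltr0n //.
    apply: (@le_trans _ _ (Num.bound d^-1)%:R).
      by apply/ltW/archi_boundP; rewrite invr_ge0 ltW.
    by rewrite ler_nat; lia.
  apply: le_trans (ler_norm A) _; apply: (@le_trans _ _ (Num.bound `|A|)%:R).
    exact/ltW/archi_boundP.
  by rewrite ler_nat; lia.
have cauchy rho e : 0 < rho -> 0 < e -> exists N0, forall N M,
    (N0 <= N)%N -> (N0 <= M)%N ->
    forall m, wt (fun n => h N n - h M n) (gaussnorm g rho) m <= e.
  move=> r0 e0; have [N0 hN0] := small rho e r0 e0; exists N0 => N M NN NM m.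
  have y0 : 0 < gaussnorm g rho by exact: (gaussnorm_gt0 gF r0 gn).
  have dF : F (fun n => h N n - h M n) by exact: calFB.
  apply: le_trans (wt_le_gaussnorm m dF y0) _.
  rewrite -(gaussnorm_fcomp dF gF r0 gn).
  apply: gaussnorm_le => // [|l]; first exact: calF_fcomp.
  have fN K : F (fun n => f n - fcomp (h K) g n) by exact: calFB.
  have -> : wt (fcomp (fun n => h N n - h M n) g) rho l =
      wt (fun n => (f n - fcomp (h M) g n) + (- (f n - fcomp (h N) g n))) rho l.
    by rewrite /wt fcomp_subl //; congr (v _ * _); ring.
  apply: (@wtD_le (fun n => f n - fcomp (h M) g n)) => //.
    exact: le_trans (wt_le_gaussnorm l (fN M) r0) (hN0 M NM).
  rewrite wtN; exact: le_trans (wt_le_gaussnorm l (fN N) r0) (hN0 N NN).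
have y1 : 0 < gaussnorm g 1 by exact: (gaussnorm_gt0 gF ltr01 gn).
have /choice[H HP] : forall m, exists l, v_cvg_to v (fun N => h N m) l.
  move=> m; apply: vc => e e0.
  have P0 := pw_gt0 q m y1.
  have [N0 hN0] := cauchy 1 (e / 2 * pw (gaussnorm g 1) m) ltr01
    (mulr_gt0 (divr_gt0 e0 (ltr0Sn _ 1)) P0).
  exists N0 => N M NN NM; have := hN0 N M NN NM m.
  by rewrite /wt ler_pM2r // => hh; apply: le_lt_trans hh _; lra.
have unif rho e : 0 < rho -> 0 < e -> exists N,
    (forall m, wt (fun n => h N n - H n) (gaussnorm g rho) m <= e) /\
    gaussnorm (fun n => f n - fcomp (h N) g n) rho <= e.
  move=> r0 e0; have [N1 hN1] := cauchy rho e r0 e0; have [N2 hN2] := small rho e r0 e0.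
  have y0 : 0 < gaussnorm g rho by exact: (gaussnorm_gt0 gF r0 gn).
  exists (N1 + N2)%N; split=> [m|]; last by apply: hN2; rewrite leq_addl.
  have P0 := pw_gt0 q m y0.
  (* The index [N3] depends on m, but the resulting bound does not, whence uniformity in m. *)
  have /v_nullP/(_ _ (divr_gt0 e0 P0))[N3 hN3] := HP m.
  have := hN1 (N1 + N2)%N (N1 + N3)%N (leq_addr _ _) (leq_addr _ _) m.
  rewrite /wt -!ler_pdivlMr // => hh.
  have -> : h (N1 + N2)%N m - H m =
      (h (N1 + N2)%N m - h (N1 + N3)%N m) + (h (N1 + N3)%N m - H m) by ring.
  by apply: v_le_add => //; apply/ltW/hN3; rewrite leq_addl.
have HF : F H.
  apply/calFP => rho' r'0.
  have [rho r0 rr] := gaussnorm_unbounded gF gn r'0.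
  have y0 : 0 < gaussnorm g rho by exact: lt_le_trans rr.
  apply: (@rnull_le _ _ _ (wt H (gaussnorm g rho))) => [m|e e0].
    by apply: wt_le => //; exact: ltW.
  have [N [hN _]] := unif rho (e / 2) r0 (divr_gt0 e0 (ltr0Sn _ 1)).
  have /calFP/(_ _ y0 _ e0)[u hu] := hF N.
  exists u => m /hu um.
  apply: (@le_lt_trans _ _ (Num.max (wt (h N) (gaussnorm g rho) m) (e / 2))).
    have -> : wt H (gaussnorm g rho) m =
        wt (fun n => h N n + (- (h N n - H n))) (gaussnorm g rho) m.
      by rewrite /wt; congr (v _ * _); ring.
    apply: wtD_le => //; first by rewrite le_max lexx.
    by rewrite wtN le_max hN orbT.
  by rewrite gt_max um; lra.
exists H => //; apply/funext => m; apply/eqP; rewrite -subr_eq0; apply/eqP.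
apply: (@v_eps_eq0 _ _ v) => e e0.
have [N [hN1 hN2]] := unif 1 e ltr01 e0.
have fN : F (fun n => f n - fcomp (h N) g n) by exact: calFB.
have hH : F (fun n => h N n - H n) by exact: calFB.
have -> : f m - fcomp H g m =
    (f m - fcomp (h N) g m) + fcomp (fun n => h N n - H n) g m.
  by rewrite fcomp_subl //; ring.
have w1 (u : int -> C) : wt u 1 m = v (u m) by rewrite /wt pw1r mulr1.
apply: v_le_add.
  rewrite -(w1 (fun n => f n - fcomp (h N) g n)); apply: le_trans hN2.
  exact: wt_le_gaussnorm.
rewrite -w1; apply: le_trans (fcomp_wt_le m hH gF ltr01 y1 _) _.
  by move=> j; exact: wt_le_gaussnorm.
exact: gaussnorm_le.
Qed.

(** By Gauss's lemma at radius 1, the norm of h - h' at |g|_1 equals that of (h - h') o g = 0. *)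
Lemma fcomp_injl g h h' n : F g -> F h -> F h' -> g n != 0 ->
  fcomp h g = fcomp h' g -> h = h'.
Proof.
move=> gF hF h'F gn E; have dF : F (fun n => h n - h' n) by exact: calFB.
have y1 : 0 < gaussnorm g 1 by exact: (gaussnorm_gt0 gF ltr01 gn).
apply/funext => m; apply/eqP; rewrite -subr_eq0; apply/negP => /negP dm.
have := gaussnorm_gt0 dF y1 dm.
rewrite -(gaussnorm_fcomp dF gF ltr01 gn) ltNge => /negP; apply.
apply: gaussnorm_le => // [|l]; first exact: calF_fcomp.
by rewrite /wt fcomp_subl // E subrr v0 mul0r.
Qed.

End FractionalSeries.

Theorem theorem5p10 (p k q : nat) (p_prime : prime p) (k_gt0 : (0 < k)%N)
    (qE : q = (p ^ k)%N)
    (R : realType) (C : closedFieldType)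
    (Fq : finFieldType) (cardFq : #|Fq| = q) (emb : {rmorphism Fq -> C})
    (v : nonarch_absval R C) (v_compl : v_complete v)
    (f g : int -> C) (fF : calF v q f) (gF : calF v q g)
    (f_neq0 : f <> (fun=> 0)) (g_neq0 : g <> (fun=> 0)) :
  (fker v q g `<=` fker v q f <->
     exists h : int -> C, calF v q h /\ f = fcomp v q h g) /\
  (forall h : int -> C, calF v q h -> f = fcomp v q h g ->
     (forall h' : int -> C, calF v q h' -> f = fcomp v q h' g -> h' = h) /\
     fker v q h = feval v q g @` fker v q f).
Proof.
have pC : p \in [pchar C].
  by apply: (rmorph_pchar emb); apply: (card_finPcharP _ p_prime); rewrite cardFq qE.
have [n gn] : exists n, g n != 0.
  apply: contrapT => h; apply: g_neq0; apply/funext => n.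
  by apply/eqP; apply/negP => /negP gn; apply: h; exists n.
have evE h z : calF v q h -> f = fcomp v q h g ->
    feval v q f z = feval v q h (feval v q g z).
  by move=> hF ->; exact: (feval_fcomp pC k_gt0 qE v_compl).
split; first split.
- move=> kgf; have [h hF fE] := ex_quotient pC k_gt0 qE v_compl fF gF gn kgf.
  by exists h.
- move=> [h [hF fE]] z; rewrite /fker /= (evE h z hF fE) => ->.
  exact: (feval0 pC k_gt0 qE v_compl).
move=> h hF fE; split=> [h' h'F fE'|].
  by apply: (fcomp_injl pC k_gt0 qE v_compl gF h'F hF gn); rewrite -fE.
apply/seteqP; split=> [w hw|w [z fz <-]].
  (* A zero w of h has the form g(z) because g is surjective, and then f(z) = h(g(z)) = 0. *)
  have [z zw] := feval_surj pC k_gt0 qE v_compl w gF gn.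
  by exists z => //; rewrite /fker /= (evE h z hF fE) zw.
by rewrite /fker /= -(evE h z hF fE).
Qed.
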